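(* Let $(\Omega,\Lambda)$ be a generalized spectral pair in $\mathbb{R}^d$ with frame constants $(a,A)$, let $B,L\subset\mathbb{R}^d$ be finite, and let $R$ be a real $d\times d$ matrix all of whose eigenvalues have modulus $>1$. Suppose conditions (i)--(v) of the context are satisfied, and let $\Lambda_n$, $\mu_n$, $\mathcal{F}_n$, $\mu$ be as defined in the context. If $$\sum_{\ell\in L}e^{i2\pi(b-b')\cdot\ell}=0\quad\text{for all } b,b'\in B\text{ with } b\ne b',$$ then $$\frac{a}{m_d(\Omega)}\|f\|_\mu^2\le\liminf_{n\to\infty}\left(\frac{|B|}{|L|}\right)^n\sum_{\lambda\in\Lambda_n}|\mathcal{F}_nf(\lambda)|^2$$ and $$\limsup_{n\to\infty}\left(\frac{|B|}{|L|}\right)^n\sum_{\lambda\in\Lambda_n}|\mathcal{F}_nf(\lambda)|^2\le\frac{A}{m_d(\Omega)}\|f\|_\mu^2$$ for all continuous functions $f\in C(\mathbb{R}^d)$.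
   Context: $m_d$ is Lebesgue measure and $e_\lambda(x):=e^{i2\pi\lambda\cdot x}$. $(\Omega,\Lambda)$, with $\Omega\subset\mathbb{R}^d$ measurable, $0<m_d(\Omega)<\infty$, $\Lambda\subset\mathbb{R}^d$, is a generalized spectral pair with frame constants $(a,A)$, $0<a\le A<\infty$, if $a\int_\Omega|f|^2dx\le\sum_{\lambda\in\Lambda}\bigl|\int_\Omega\overline{e_\lambda}f\,dx\bigr|^2\le A\int_\Omega|f|^2dx$ for all $f\in L^2(\Omega)$. $\sigma_b(x)=R^{-1}(x+b)$ $(b\in B)$, $\tau_\ell(s)=R^*(s+\ell)$ $(\ell\in L)$, $R^*$ the transpose. $\Omega_0=\Omega$, $\Lambda_0=\Lambda$, $\Omega_{n+1}=\bigcup_{b\in B}\sigma_b(\Omega_n)$, $\Lambda_{n+1}=\bigcup_{\ell\in L}\tau_\ell(\Lambda_n)$. For $S\subset\mathbb{R}^d$, $S^\circ:=\{t\in\mathbb{R}^d:t\cdot s\in\mathbb{Z}\ \forall s\in S\}$, $S^{\circ\circ}=(S^\circ)^\circ$. Conditions: (i) the matrix $(e^{i2\pi\ell\cdot b})_{\ell\in L,b\in B}$ has rank $|B|$; (ii) $R(\Lambda^\circ)\subset\Lambda^\circ$; (iii) $B\subset\Lambda^\circ$; (iv) $L\subset (R^* )^{-1}(\Lambda^{\circ\circ})$; (v) $(\ell+\Lambda^{\circ\circ})\cap(\ell'+\Lambda^{\circ\circ})=\emptyset$ for all $\ell\ne\ell'$ in $L$. $\mu_n$ is the probability measure $\mu_n(\Delta)=\frac{|\det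 R|^n}{|B|^n m_d(\Omega)}m_d(\Delta\cap\Omega_n)$, and $\mathcal{F}_nf(\lambda)=\int f\,\overline{e_\lambda}\,d\mu_n$. $\mu$ is the limit of $(\mu_n)$, i.e. Hutchinson's unique (compactly supported) Borel probability measure with $\mu=\frac1{|B|}\sum_{b\in B}\mu\circ\sigma_b^{-1}$. $\|f\|_\mu^2=\int|f|^2d\mu$.
   Formalization: The formal theorem assumes in addition that Ω is bounded or that f is bounded; without this, for unbounded Ω and rapidly growing continuous f, the transform F_n f may fail to exist and the upper bound can be false. *)

(* Defs.v *)
From HB Require Import structures.
From mathcomp Require Import all_boot all_order all_algebra finmap.
From mathcomp Require Import all_classical all_reals all_analysis.
From mathcomp Require Import complex.

Set Implicit Arguments.
Unset Strict Implicit.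
Unset Printing Implicit Defensive.
Import Order.TTheory GRing.Theory Num.Theory.
Import numFieldNormedType.Exports.
Import ComplexField.Normc.

Local Open Scope classical_set_scope.
Local Open Scope ring_scope.
Local Open Scope complex_scope.

(* As for n.-tuple T in the library, 'cV[T]_n carries the product sigma-algebra,
   i.e. the one generated by the coordinate projections; for T = R it is the
   Borel sigma-algebra of R^n. *)
Definition measure_cV_display : measure_display -> measure_display.
Proof. exact. Qed.

Section measurable_cV.
Context {d} {T : measurableType d}.
Variable n : nat.

Let coors : 'I_n -> 'cV[T]_n -> T := fun i v => v i ord0.

Let cV_set0 : g_sigma_preimage coors set0.
Proof. exact: sigma_algebra0. Qed.

Let cV_setC A : g_sigma_preimage coors A -> g_sigma_preimage coors (~` A).
Proof. exact: sigma_algebraC. Qed.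

Let cV_bigcup (F : _^nat) : (forall i, g_sigma_preimage coors (F i)) ->
  g_sigma_preimage coors (\bigcup_i (F i)).
Proof. exact: sigma_algebra_bigcup. Qed.

HB.instance Definition _ := @isMeasurable.Build (measure_cV_display d)
  'cV[T]_n (g_sigma_preimage coors) cV_set0 cV_setC cV_bigcup.

End measurable_cV.


Lemma measurable_fun_cVP d d' (T : measurableType d) (T' : measurableType d')
    n (f : T -> 'cV[T']_n) :
  (forall i, measurable_fun setT (fun x => f x i ord0)) ->
  measurable_fun setT f.
Proof.
move=> mf.
suff sub : g_sigma_preimage (fun (i : 'I_n) x => f x i ord0) `<=` measurable.
  move=> _ Y mY; rewrite setTI; apply: sub.
  rewrite (@g_sigma_preimage_comp _ _ n _ (fun i (v : 'cV[T']_n) => v i ord0)).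
  by exists Y => //; rewrite setTI.
apply: smallest_sub; first exact: sigma_algebra_measurable.
rewrite -bigcup_seq => A [i _ [B mB <-]]; exact: mf.
Qed.

Lemma measurable_coord d (T : measurableType d) n (i : 'I_n) :
  measurable_fun setT (fun v : 'cV[T]_n => v i ord0).
Proof.
move=> _ Y mY; rewrite setTI; apply: sub_sigma_algebra.
rewrite -bigcup_seq; exists i => /=; first by rewrite mem_index_enum.
by exists Y => //; rewrite setTI.
Qed.

Section lebesgue_cV.
Context {R : realType}.

Definition cons_cV n (p : R * 'cV[R]_n) : 'cV[R]_n.+1 :=
  col_mx (const_mx p.1 : 'cV[R]_1) p.2.

Definition uncons_cV n (v : 'cV[R]_n.+1) : R * 'cV[R]_n :=
  (v ord0 ord0, \col_i v (lift ord0 i) ord0).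

Lemma cons_cVE n p i : @cons_cV n p i ord0 =
  if unlift ord0 i is Some j then p.2 j ord0 else p.1.
Proof.
case: unliftP => [j|] ->.
  by rewrite (_ : lift ord0 j = rshift 1 j); [exact: col_mxEd|exact/val_inj].
rewrite (_ : ord0 = lshift n (ord0 : 'I_1) :> 'I_n.+1); last exact/val_inj.
by rewrite [LHS](col_mxEu (const_mx p.1 : 'cV[R]_1)) mxE.
Qed.

Lemma cons_cVK n : cancel (@cons_cV n) (@uncons_cV n).
Proof.
move=> [x v]; rewrite /uncons_cV cons_cVE unlift_none; congr pair.
by apply/colP => i; rewrite mxE cons_cVE liftK.
Qed.

Lemma measurable_cons_cV n : measurable_fun setT (@cons_cV n).
Proof.
apply: measurable_fun_cVP => i; under eq_fun do rewrite cons_cVE.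
case: (unlift _ _) => [j|]; last exact: measurable_fst.
exact: measurableT_comp (measurable_coord j) measurable_snd.
Qed.

Lemma measurable_uncons_cV n : measurable_fun setT (@uncons_cV n).
Proof.
apply/measurable_fun_pairP; split; first exact: measurable_coord.
apply: measurable_fun_cVP => i; rewrite /comp /=.
by under eq_fun do rewrite mxE; exact: measurable_coord.
Qed.

Section lebesgue_cV_step.
Context n (m : {sigma_finite_measure set 'cV[R]_n -> \bar R}).

Definition lebesgue_cV_step : set 'cV[R]_n.+1 -> \bar R :=
  pushforward (lebesgue_measure \x m)%E (@cons_cV n).

Let step0 : lebesgue_cV_step set0 = 0%E.
Proof. by rewrite /lebesgue_cV_step /pushforward preimage_set0 measure0. Qed.

Let step_ge0 A : (0 <= lebesgue_cV_step A)%E.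
Proof. by rewrite /lebesgue_cV_step /pushforward measure_ge0. Qed.

Let step_sigma_additive : semi_sigma_additive lebesgue_cV_step.
Proof.
move=> F mF tF mUF; rewrite /lebesgue_cV_step /pushforward preimage_bigcup.
apply: measure_semi_sigma_additive.
- by move=> k; rewrite -[X in measurable X]setTI; exact: measurable_cons_cV.
- apply/trivIsetP => /= i j _ _ ij; rewrite -preimage_setI.
  by move/trivIsetP : tF => /(_ _ _ _ _ ij) ->//; rewrite preimage_set0.
- rewrite -preimage_bigcup -[X in measurable X]setTI.
  exact: measurable_cons_cV.
Qed.

HB.instance Definition _ := isMeasure.Build _ _ _ lebesgue_cV_step
  step0 step_ge0 step_sigma_additive.

Let step_sigma_finite : sigma_finite setT lebesgue_cV_step.
Proof.
have /sigma_finiteP[F [TF ndF Foo]] := sigma_finiteT (@lebesgue_measure R).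
have /sigma_finiteP[G [TG ndG Goo]] := sigma_finiteT m.
exists (fun k => @uncons_cV n @^-1` (F k `*` G k)) => [|k].
  rewrite -preimage_bigcup (_ : \bigcup_k _ = setT) ?preimage_setT//.
  apply/esym.
  rewrite -setXTT TF TG predeqE => -[x y]; split=> [[/= [k _ Fx] [l _ Gy]]|].
    exists (maxn k l) => //; split => /=.
    - by move: x Fx; exact/subsetPset/ndF/leq_maxl.
    - by move: y Gy; exact/subsetPset/ndG/leq_maxr.
  by move=> [k _ [/= ? ?]]; split; exists k.
have [mF Fk] := Foo k; have [mG Gk] := Goo k; split.
  by rewrite -[X in measurable X]setTI; apply: measurable_uncons_cV => //;
    exact: measurableX.
rewrite /lebesgue_cV_step /pushforward -comp_preimage.
rewrite (_ : _ \o _ = id); last by apply/funext; exact: cons_cVK.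
by rewrite preimage_id product_measure1E// lte_mul_pinfty// ge0_fin_numE.
Qed.

HB.instance Definition _ := Measure_isSigmaFinite.Build _ _ _ lebesgue_cV_step
  step_sigma_finite.

End lebesgue_cV_step.

(* Lebesgue measure on the Borel sets of R^n, as the n-fold product of the
   Lebesgue measure of the line (a point mass when n = 0). *)
Fixpoint lebesgue_cV (n : nat) : {sigma_finite_measure set 'cV[R]_n -> \bar R} :=
  if n is n'.+1 then lebesgue_cV_step (lebesgue_cV n') else \d_(0 : 'cV[R]_0).

End lebesgue_cV.

(* Completion of [lebesgue_cV]: the measurable sets of [lebesgueT R n], an alias
   of R^n, are the Lebesgue measurable sets; on an arbitrary set,
   [lebesgue_measureT] is the Lebesgue outer measure. *)
Definition lebesgueT (R : realType) (n : nat) : measurableType _ :=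
  caratheodory_type (@lebesgue_cV R n)^*%mu.

Definition lebesgue_measureT (R : realType) (n : nat) :
    {measure set lebesgueT R n -> \bar R} :=
  @completed_measure_extension _ _ _ (@lebesgue_cV R n).

Section complex_functions.
Context {R : realType}.

Definition Cintegral d (T : measurableType d) (m : {measure set T -> \bar R})
    (D : set T) (f : T -> R[i]) : R[i] :=
  Rintegral m D (fun x => complex.Re (f x)) +i*
  Rintegral m D (fun x => complex.Im (f x)).

Definition sqnorm2 d (T : measurableType d) (m : {measure set T -> \bar R})
    (D : set T) (f : T -> R[i]) : \bar R :=
  (\int[m]_(x in D) (normc (f x) ^+ 2)%:E)%E.

Definition L2 d (T : measurableType d) (m : {measure set T -> \bar R})
    (D : set T) (f : T -> R[i]) : Prop :=
  [/\ measurable_fun D (fun x => complex.Re (f x)),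
      measurable_fun D (fun x => complex.Im (f x)) &
      (sqnorm2 m D f < +oo)%E].

Definition dotv n (u v : 'cV[R]_n) : R := (u^T *m v) ord0 ord0.

Definition expi n (lam x : 'cV[R]_n) : R[i] :=
  cos (2 * pi * dotv lam x) +i* sin (2 * pi * dotv lam x).

Definition dual_set n (S : set 'cV[R]_n) : set 'cV[R]_n :=
  [set t | forall s, S s -> dotv t s \is a Num.int].

End complex_functions.

Section affine_fractal.
Context {R : realType} {d : nat}.
Local Notation V := 'cV[R]_d.
Local Notation m_d := (lebesgue_measureT R d).

Definition generalized_spectral_pair (Omega Lambda : set V) (a A : R) : Prop :=
  [/\ measurable (Omega : set (lebesgueT R d)),
      (0 < m_d Omega < +oo)%E,
      0 < a <= A &
      forall f : V -> R[i], L2 m_d Omega f ->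
        let S := (\esum_(lam in Lambda)
          (normc (Cintegral m_d Omega (fun x => (expi lam x)^*%C * f x)) ^+ 2)%:E)%E in
        (a%:E * sqnorm2 m_d Omega f <= S)%E /\
        (S <= A%:E * sqnorm2 m_d Omega f)%E].

Variables (M : 'M[R]_d) (B L : {fset V}).

Definition sigma_map (b x : V) : V := invmx M *m (x + b).
Definition tau_map (l s : V) : V := M^T *m (s + l).

Fixpoint Omega_iter (Omega : set V) (n : nat) : set V :=
  if n is n'.+1 then \bigcup_(b in [set` B]) (sigma_map b @` Omega_iter Omega n')
  else Omega.

Fixpoint Lambda_iter (Lambda : set V) (n : nat) : set V :=
  if n is n'.+1 then \bigcup_(l in [set` L]) (tau_map l @` Lambda_iter Lambda n')
  else Lambda.

Definition exp_matrix : 'M[R[i]]_(#|` L|, #|` B|) :=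
  \matrix_(i, j) expi (nth 0 L i) (nth 0 B j).

Definition expansive : Prop :=
  forall z : R[i], eigenvalue (map_mx (real_complex R) M) z -> 1 < normc z.

Definition hutchinson_measure (mu : probability V R) : Prop :=
  (exists2 K : set V, compact K & mu K = 1%E) /\
  forall D : set V, measurable D ->
    (mu D = (#|` B|%:R^-1)%:E * \sum_(b <- B) mu (sigma_map b @^-1` D))%E.

Section level_measure.
Variables (Omega : set V) (n : nat).

(* |det M|^n / (|B|^n m_d(Omega)) times the restriction of m_d to Omega_n. *)
Definition level_measure (D : set V) : \bar R :=
  ((`|\det M| ^+ n / (#|` B|%:R ^+ n * fine (m_d Omega)))%:E *
   m_d (D `&` Omega_iter Omega n))%E.

Let c_ge0 : 0 <= `|\det M| ^+ n / (#|` B|%:R ^+ n * fine (m_d Omega)).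
Proof.
by rewrite divr_ge0 ?mulr_ge0 ?exprn_ge0 ?ler0n ?fine_ge0 ?outer_measure_ge0.
Qed.

Let mu_0 : level_measure set0 = 0%E.
Proof. by rewrite /level_measure set0I measure0 mule0. Qed.

Let mu_ge0 D : (0 <= level_measure D)%E.
Proof. by rewrite /level_measure mule_ge0 ?lee_fin// outer_measure_ge0. Qed.

(* No measurability of Omega_n is needed: sets of R^d measurable for the
   product sigma-algebra are Caratheodory measurable. *)
Let mu_semi_sigma_additive : semi_sigma_additive level_measure.
Proof.
move=> F mF tF mUF; set X := Omega_iter Omega n; rewrite /level_measure -/X.
pose nu := (@lebesgue_cV R d)^*%mu.
have cF k : nu.-cara.-measurable (F k) by exact: caratheodory_measurable_mu_ext.
have nuE : nu (X `&` \bigcup_k F k) = (\sum_(k <oo) nu (X `&` F k))%E.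
  apply/eqP; rewrite eq_le outer_measure_bigcup_lim /=.
  apply: le_trans (caratheodory_lime_le cF tF _).
  under [X in (_ <= X + _)%E]eq_eseriesr => k _.
    rewrite -setIA (_ : \bigcup_k F k `&` F k = F k); last first.
      by apply/setIidPr; exact: bigcup_sup.
    over.
  by rewrite leeDl// outer_measure_ge0.
rewrite setIC [m_d (X `&` _)]nuE -nneseriesZl//; last first.
  by move=> k _; exact: outer_measure_ge0.
under eq_fun do under eq_bigr do rewrite setIC.
apply: is_cvg_nneseries => k _ _.
by rewrite mule_ge0 ?lee_fin// outer_measure_ge0.
Qed.

HB.instance Definition _ := isMeasure.Build _ _ _ level_measure
  mu_0 mu_ge0 mu_semi_sigma_additive.

Definition level_Fourier (f : V -> R[i]) (lam : V) : R[i] :=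
  Cintegral level_measure setT (fun x => f x * (expi lam x)^*%C).

End level_measure.

End affine_fractal.

(* Main.v *)
Require Import Defs.
From mathcomp Require Import all_boot all_order all_algebra finmap.
From mathcomp Require Import all_classical all_reals all_analysis.
From mathcomp Require Import complex.
From mathcomp Require Import measurable_realfun ring lra.

(** Two facts together give the result.

(1) Spectral pairs pass from one level to the next.  For [b] in [B] and [s] in
[Lambda] one has [s . b] in [Z], so with [x = sigma_b y] and [t = tau_l s] the
exponentials satisfy [e_t(x) = e_s(y) e_l(y) e_l(b)].  Hence the Fourier
coefficients of [f] over [Omega_(n+1)] at the points [tau_l s] are, up to the
Jacobian, the coefficients over [Omega_n] at the points [s] of
  [g_l(y) = conj e_l(y) * sum_b (conj e_l(b)) f(sigma_b y)].
The orthogonality hypothesis says that the columns of [(e_l(b))] are orthogonal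
of square length [|L|], so [sum_l |g_l|^2 = |L| sum_b |f o sigma_b|^2].  Summing
the frame inequalities of [(Omega_n, Lambda_n)] for the functions [g_l] gives
those of [(Omega_(n+1), Lambda_(n+1))] with both constants multiplied by
[|L| / |det M|] ([generalized_spectral_pair_step]).  This needs the pieces
[sigma_b Omega_n] to be almost disjoint, which is itself a consequence of the
lower frame bound: if [G] and [G + t] are disjoint subsets of [Omega] and [t] is
in the dual of [Lambda], then [1_G - 1_(G+t)] has only zero coefficients, so [G]
is null ([null_of_disjoint_translate]).  It also needs the sets
[tau_l Lambda_n] to be disjoint; since all the [Lambda_n] stay inside the double
dual of [Lambda], disjointness of the cosets of the double dual by [L] gives
this.  After normalization the constants
for [mu_n] do not depend on [n]:
  [a / m(Omega) * int |f|^2 dmu_n <= S_n <= A / m(Omega) * int |f|^2 dmu_n]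
([level_frame_bounds]).

(2) The integrals [int |f|^2 dmu_n] tend to [int |f|^2 dmu].  Let [P] average a
function over the branches, [P g = |B|^-1 sum_b g o sigma_b].  Then
[int g dmu_n = int (P^n g) dmu_0], while self-similarity of [mu] gives
[int g dmu = int (P^n g) dmu].  The two values [P^n g x] and [P^n g 0] are
averages of [g] over points that differ by [M^(-n) x], so their difference
tends to [0] by uniform continuity; by dominated convergence both integrals are
asymptotic to [P^n g 0] ([integral_iter_avg_cvg]), and the one against [mu] is
constant.

Two pieces of theory support this.  The powers of [M^-1] have summable entries:
by Cayley-Hamilton the product of the factors [M^-1 - z], over the eigenvalues
[z] with their multiplicities, kills every vector, and each factor costs one first-order recurrence with
ratio [|z| < 1] ([orbit_sums_bounded]).  Lebesgue measure, given as an iterated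
product and then completed, is multiplied by [|det|] under a linear map: block
elimination and Tonelli's theorem in the incomplete case ([scales_mulmx]), and
invariance of the outer measure for the completion
([lebesgueT_affine_preimage]). *)

Set Implicit Arguments.
Unset Strict Implicit.
Unset Printing Implicit Defensive.
Import Order.TTheory GRing.Theory Num.Theory.
Import numFieldNormedType.Exports.
Import ComplexField.Normc.
Local Open Scope classical_set_scope.
Local Open Scope ring_scope.
Local Open Scope complex_scope.

(** * Inverse iterates of an expansive matrix *)

(** Summing the recurrence bounds the total of [y] by [y 0 + U] plus [r] times
itself. *)
Lemma sum_le_of_contractive_recurrence (R : realFieldType) (r U : R)
    (y u : nat -> R) :
  0 <= r < 1 -> (forall n, 0 <= y n) ->
  (forall n, y n.+1 <= r * y n + u n) ->
  (forall m, \sum_(n < m) u n <= U) ->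
  forall m, \sum_(n < m) y n <= (y 0%N + U) / (1 - r).
Proof.
move=> /andP[r0 r1] y0 yS uU m.
rewrite ler_pdivlMr ?subr_gt0// mulrBr mulr1 lerBlDr.
have -> : y 0%N + U + (\sum_(n < m) y n) * r = y 0%N + (r * (\sum_(n < m) y n) + U).
  by rewrite mulrC; ring.
apply: (@le_trans _ _ (\sum_(n < m.+1) y n)).
  by rewrite big_ord_recr lerDl; exact: y0.
rewrite big_ord_recl lerD2l/=.
apply: le_trans (ler_sum _ (fun (n : 'I_m) _ => yS n)) _.
by rewrite big_split/= -mulr_sumr lerD2l uU.
Qed.

Lemma iter_mulmx_mulmx (K : pzRingType) d (T : 'M[K]_d) (P : 'M[K]_d) n v :
  GRing.comm T P -> iter n (mulmx T) (P *m v) = P *m iter n (mulmx T) v :> 'cV_d.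
Proof.
move=> TP; elim: n => //= n ->.
by rewrite !mulmxA; congr (_ *m _); exact: TP.
Qed.

Lemma iter_mulmxD (K : pzRingType) d (T : 'M[K]_d) n (u v : 'cV_d) :
  iter n (mulmx T) (u + v) = iter n (mulmx T) u + iter n (mulmx T) v.
Proof. by elim: n => //= n ->; rewrite mulmxDr. Qed.

Lemma iter_mulmxZ (K : comPzRingType) d (T : 'M[K]_d) n c (u : 'cV_d) :
  iter n (mulmx T) (c *: u) = c *: iter n (mulmx T) u.
Proof. by elim: n => //= n ->; rewrite -scalemxAr. Qed.

Lemma iter_mulmx_sum (K : pzRingType) d (T : 'M[K]_d) n I (s : seq I)
    (F : I -> 'cV_d) :
  iter n (mulmx T) (\sum_(i <- s) F i) = \sum_(i <- s) iter n (mulmx T) (F i).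
Proof.
elim: s => [|i s ih]; last by rewrite !big_cons iter_mulmxD ih.
by rewrite !big_nil; elim: n => //= n ->; rewrite mulmx0.
Qed.

Section orbit_sums.
Variable R : rcfType.
Local Notation C := R[i].

Lemma normc_ge0 (z : C) : 0 <= normc z.
Proof. by case: z => x y /=; rewrite sqrtr_ge0. Qed.

Lemma normc_real (x : R) : normc (x%:C) = `|x|.
Proof. by rewrite /= expr0n/= addr0 sqrtr_sqr. Qed.

(** Induction on the number of factors: [u = (T - z) v] is killed by the
remaining ones, and [T^(n+1) v = z T^n v + T^n u].  Summability of the orbit,
unlike a geometric rate, passes through this recurrence even when eigenvalues
are repeated. *)
Lemma orbit_sums_bounded_of_split d (T : 'M[C]_d.+1) (s : seq C) :
  all (fun z => normc z < 1) s ->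
  forall v : 'cV[C]_d.+1,
  (\prod_(z <- s) (T - z%:M)) *m v = 0 ->
  forall i, exists K, forall m,
    \sum_(n < m) normc (iter n (mulmx T) v i ord0) <= K.
Proof.
have cs (X : 'M[C]_d.+1) z : GRing.comm X z%:M by exact: (scalar_mxC z X).
elim: s => [_ v|z s ih /= /andP[z1 s1] v].
  rewrite big_nil mul1mx => -> i; exists 0 => m.
  rewrite big1// => n _; rewrite (_ : iter _ _ _ = 0) ?mxE ?normc0//.
  by elim: (val n) => //= k ->; rewrite mulmx0.
rewrite big_cons => Tv i.
have [|U hU] := ih s1 ((T - z%:M) *m v) _ i.
  rewrite mulmxA -Tv; congr (_ *m _).
  suff : GRing.comm (T - z%:M) (\prod_(j <- s) (T - j%:M)) by move=> H; exact: esym H.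
  apply: commr_prod => j _; apply: commrB; last exact: cs.
  by apply/commr_sym/commrB => //; exact: cs.
exists ((normc (v i ord0) + U) / (1 - normc z)).
apply: (@sum_le_of_contractive_recurrence _ (normc z) U
  (fun n => normc (iter n (mulmx T) v i ord0))
  (fun n => normc (iter n (mulmx T) ((T - z%:M) *m v) i ord0))) => //.
- by rewrite normc_ge0 z1.
- by move=> n; exact: normc_ge0.
- move=> n; rewrite -normcM iter_mulmx_mulmx; last first.
    by apply: commrB => //; exact: cs.
  rewrite (_ : iter n.+1 _ v i ord0 = z * iter n (mulmx T) v i ord0 +
     ((T - z%:M) *m iter n (mulmx T) v) i ord0); first exact: le_normcD.
  by rewrite mulmxBl mul_scalar_mx !mxE addrCA subrr addr0.
Qed.

End orbit_sums.

Lemma expansive_unitmx (R : realType) d (M : 'M[R]_d) :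
  expansive M -> M \in unitmx.
Proof.
move=> hM; apply: contraT => nuM.
have /rowV0Pn[v] : kermx M != 0 by rewrite kermx_eq0 row_free_unit.
move=> /sub_kermxP vM v0.
have /hM : eigenvalue (map_mx (real_complex R) M) 0; last first.
  by rewrite normc0 ltr10.
apply/eigenvalueP; exists (map_mx (real_complex R) v).
  by rewrite -map_mxM vM map_mx0 scale0r.
by rewrite map_mx_eq0.
Qed.

(** The eigenvalues of the inverse are the inverses of the eigenvalues of [M],
so they lie in the open unit disc, and Cayley-Hamilton provides the product of
factors to which the previous lemma applies. *)
Lemma orbit_sums_bounded (R : realType) d (M : 'M[R]_d) (v : 'cV[R]_d) :
  expansive M ->
  exists K, forall i m, \sum_(n < m) `|iter n (mulmx (invmx M)) v i ord0| <= K.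
Proof.
move=> hM; have H i : exists K, forall m,
    \sum_(n < m) `|iter n (mulmx (invmx M)) v i ord0| <= K.
  case: d M hM v i => [? ? ? [] //|d' M' hM' v i].
  pose N := invmx M'; pose T := map_mx (real_complex R) N.
  have uM := expansive_unitmx hM'.
  have TM : T *m map_mx (real_complex R) M' = 1%:M.
    by rewrite -map_mxM mulVmx ?map_mx1.
  have [s sE] := closed_field_poly_normal (char_poly T).
  rewrite (monicP (char_poly_monic T)) scale1r in sE.
  have s1 : all (fun z => normc z < 1) s.
    apply/allP => z zs.
    have /eigenvalueP[w wT w0] : eigenvalue T z.
      by rewrite eigenvalue_root_char sE root_prod_XsubC.
    have wE : w = z *: (w *m map_mx (real_complex R) M').
      by rewrite scalemxAl -wT -mulmxA TM mulmx1.
    have z0 : z != 0 by apply: contra_neq w0 => z0; rewrite wE z0 scale0r.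
    have : eigenvalue (map_mx (real_complex R) M') z^-1.
      by apply/eigenvalueP; exists w => //; rewrite {2}wE scalerA mulVf// scale1r.
    move=> /hM'; rewrite normcV => z1.
    have nz0 : 0 < normc z.
      by rewrite lt_neqAle normc_ge0 andbT eq_sym; apply: contra_neq z0 => /eq0_normc.
    by move: z1; rewrite -[_^-1]mul1r ltr_pdivlMr// mul1r.
  have [|K hK] := @orbit_sums_bounded_of_split R d' T s s1
      (map_mx (real_complex R) v) _ i.
    rewrite (_ : \prod_(z <- s) _ = horner_mx T (char_poly T)).
      by rewrite Cayley_Hamilton mul0mx.
    rewrite sE rmorph_prod; apply: eq_bigr => z _.
    by rewrite rmorphB/= horner_mx_X horner_mx_C.
  exists K => m; apply: le_trans (hK m); apply: ler_sum => n _.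
  rewrite (_ : iter n (mulmx T) _ = map_mx (real_complex R) (iter n (mulmx N) v)).
    by rewrite mxE normc_real.
  by elim: (val n) => //= k ->; rewrite -map_mxM.
have [K hK] := choice H; exists (\sum_i `|K i|) => i m.
apply: le_trans (hK i m) _; apply: le_trans (ler_norm _) _.
by rewrite (bigD1 i)//= lerDl sumr_ge0.
Qed.

Section orbits.
Variables (R : realType) (d : nat) (M : 'M[R]_d) (B : {fset 'cV[R]_d}).
Hypothesis hM : expansive M.
Local Notation V := 'cV[R]_d.
Local Notation N := (mulmx (invmx M)).

Definition box (r : R) : set V := [set x | forall i, `|x i ord0| <= r].

(** The bound has to be uniform over the box, so it is taken on the basis
vectors. *)
Lemma orbit_sums_bounded_box (r : R) : exists u : nat -> R,
  [/\ forall n, 0 <= u n,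
      forall n x i, box r x -> `|iter n N x i ord0| <= u n &
      exists K, forall m, \sum_(n < m) u n <= K].
Proof.
have [K hK] := choice (fun j => orbit_sums_bounded (delta_mx j ord0 : V) hM).
exists (fun n => \sum_j `|r| * \sum_i `|iter n N (delta_mx j ord0 : V) i ord0|).
split=> [n|n x i xr|].
- by apply: sumr_ge0 => j _; rewrite mulr_ge0// sumr_ge0.
- have -> : x = \sum_j x j ord0 *: delta_mx j ord0.
    rewrite [LHS]matrix_sum_delta; apply: eq_bigr => j _.
    by rewrite big_ord1.
  rewrite iter_mulmx_sum summxE; apply: le_trans (ler_norm_sum _ _ _) _.
  apply: ler_sum => j _; rewrite iter_mulmxZ mxE normrM ler_pM//.
    exact: le_trans (xr j) (ler_norm _).
  by rewrite (bigD1 i)//= lerDl sumr_ge0.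
- exists (\sum_j `|r| * \sum_(i < d) K j) => m.
  rewrite exchange_big; apply: ler_sum => j _.
  rewrite -mulr_sumr ler_wpM2l// exchange_big; apply: ler_sum => i _.
  exact: hK.
Qed.

Lemma box_le r r' : r <= r' -> box r `<=` box r'.
Proof. by move=> rr x xr i; exact: le_trans (xr i) rr. Qed.

(** A point of level [n] is [N^n x] plus vectors [N^k b] with [1 <= k <= n],
one for each [k]; their total is controlled by the summable bounds.  The
induction runs on [N^m] applied to that point, because the new branch is
applied on the outside. *)
Lemma Omega_iter_box (r : R) : exists C, forall n,
  Omega_iter M B (box r) n `<=` box C.
Proof.
pose r' := \sum_(b <- B) \sum_i `|b i ord0|.
have Br b : b \in B -> box r' b.
  move=> bB i; rewrite /r' (big_fsetD1 b)//= (bigD1 i)//= -addrA lerDl.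
  by rewrite addr_ge0// sumr_ge0// => ? _; rewrite sumr_ge0.
have [u [u0 hu [K hK]]] := orbit_sums_bounded_box r.
have [u' [u'0 hu' [K' hK']]] := orbit_sums_bounded_box r'.
have H n m x : Omega_iter M B (box r) n x -> forall i,
    `|iter m N x i ord0| <= u (m + n)%N + \sum_(k < n) u' (m + k.+1)%N.
  elim: n m x => [|n ih] m x /=.
    by move=> xr i; rewrite addn0 big_ord0 addr0; exact: hu.
  move=> [b /= bB [y yn <-]] i; rewrite /sigma_map -iterSr iter_mulmxD mxE.
  apply: le_trans (ler_normD _ _) _.
  rewrite big_ord_recl -addSnnS [X in _ <= _ + X]addrC addrA lerD//.
    apply: le_trans (ih m.+1 y yn i) _; rewrite lerD2l.
    by apply: ler_sum => k _; rewrite /bump/= addSnnS.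
  by rewrite addn1; apply: hu'; exact: Br.
exists (K + K') => n x xn i.
have := H n 0%N x xn i; rewrite /= add0n => /le_trans; apply.
apply: lerD.
  by apply: le_trans (hK n.+1); rewrite big_ord_recr lerDr sumr_ge0.
by apply: le_trans (hK' n.+1); rewrite big_ord_recl lerDr.
Qed.

Lemma orbit_cvg0 (x : V) (e : R) : 0 < e ->
  \forall n \near \oo, box e (iter n N x).
Proof.
move=> e0.
have H i : \forall n \near \oo, `|iter n N x i ord0| <= e.
  have [K hK] := orbit_sums_bounded x hM.
  have : cvgn (series (fun n => `|iter n N x i ord0|)).
    apply: nondecreasing_is_cvgn.
      by apply: nondecreasing_series => n _ _.
    exists K => _ [m _ <-]; rewrite /series/= big_mkord; exact: hK.
  move/cvg_series_cvg_0 => /cvgr0Pnorm_le/(_ e e0).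
  by apply: filterS => n; rewrite normr_id.
exact: filter_forall H.
Qed.

Lemma Omega_iter_subset S S' n : S `<=` S' ->
  Omega_iter M B S n `<=` Omega_iter M B S' n.
Proof.
move=> SS; elim: n => //= n ih x [b bB [y yn <-]].
by exists b => //; exists y => //; exact: ih.
Qed.

End orbits.

(** * Lebesgue measure under affine maps *)

(** The changes of variables on the line and for the completed measure, and the
passage between the completed measure and the level measures, are instances. *)
Lemma ge0_integral_comp_scale d1 d2 (T1 : measurableType d1)
    (T2 : measurableType d2) (R : realType)
    (m1 : {measure set T1 -> \bar R}) (m2 : {measure set T2 -> \bar R})
    (phi : T1 -> T2) (c : R) (D : set T2) (f : T2 -> \bar R) :
  measurable_fun setT phi -> 0 <= c -> measurable D ->
  (forall E, measurable E -> E `<=` D -> m1 (phi @^-1` E) = (c%:E * m2 E)%E) ->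
  measurable_fun D f -> (forall y, D y -> (0 <= f y)%E) ->
  (\int[m1]_(x in phi @^-1` D) f (phi x) = c%:E * \int[m2]_(y in D) f y)%E.
Proof.
move=> mphi c0 mD mE mf f0.
have f0' : {in D, forall y, (0 <= f y)%E} by move=> y; rewrite inE; exact: f0.
rewrite -(ge0_integral_pushforward mphi m1 mD mf f0').
rewrite [LHS](eq_measure_integral (mscale (NngNum c0) m2)); last exact: mE.
by rewrite ge0_integral_mscale.
Qed.

Section lebesgue_line.
Context {R : realType}.
Local Notation leb := (@lebesgue_measure R).

Lemma measurable_affine_line (al c : R) :
  measurable_fun [set: measurableTypeR R] (fun x : R => al * x + c : measurableTypeR R).
Proof.
have H : measurable_fun [set: R] (fun x : R => al * x + c).
  by apply: measurable_funD => //; exact: measurable_funM.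
exact: H.
Qed.

(** Lebesgue measure is determined by its values on half-open intervals; a
negative slope exchanges their two ends. *)
Lemma lebesgue_measure_affine_preimage (al c : R) (E : set R) : al != 0 ->
  measurable (E : set (measurableTypeR R)) ->
  leb E = (`|al|%:E * leb ((fun x => (al * x + c)%R) @^-1` E))%E.
Proof.
move=> al0 mE.
pose phi (x : measurableTypeR R) : measurableTypeR R := al * x + c.
have mphi : measurable_fun setT phi := measurable_affine_line al c.
(* The measure structure of a pushforward needs the measurability proof. *)
pose im := measure_function_pushforward__canonical__measure_function_Measure leb mphi.
pose nu := mscale (NngNum (normr_ge0 al)) im.
change (leb E = nu E).
apply: lebesgue_measure_unique => // _ [[a b] _ <-].
change (leb `]a, b]%classic = `|al|%:E * leb (phi @^-1` `]a, b]%classic))%E.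
have [al_gt0|al_lt0|] := ltgtP al 0; last by move/eqP; rewrite (negbTE al0).
- rewrite (_ : _ @^-1` _ = `[(b - c) / al, (a - c) / al[%classic); last first.
    apply/seteqP; split=> x /=; rewrite !in_itv/= => /andP[].
      rewrite -ltrBlDr -lerBrDr => h1 h2.
      by rewrite ler_ndivrMr// ltr_ndivlMr// ![x * _]mulrC h1 h2.
    rewrite ler_ndivrMr// ltr_ndivlMr// ![x * _]mulrC => h1 h2.
    by rewrite -ltrBlDr -lerBrDr h1 h2.
  rewrite !lebesgue_measure_itv/= !lte_fin.
  rewrite ltr_nM2r ?invr_lt0// ltrD2r.
  case: ifPn => ab; last by rewrite mule0.
  rewrite -!EFinB -EFinM ltr0_norm//; congr EFin.
  by field.
- rewrite (_ : _ @^-1` _ = `](a - c) / al, (b - c) / al]%classic); last first.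
    apply/seteqP; split=> x /=; rewrite !in_itv/= => /andP[].
      rewrite -ltrBlDr -lerBrDr => h1 h2.
      by rewrite ler_pdivlMr// ltr_pdivrMr// ![x * _]mulrC h1 h2.
    rewrite ler_pdivlMr// ltr_pdivrMr// ![x * _]mulrC => h1 h2.
    by rewrite -ltrBlDr -lerBrDr h1 h2.
  rewrite !lebesgue_measure_itv/= !lte_fin.
  rewrite ltr_pM2r ?invr_gt0// ltrD2r.
  case: ifPn => ab; last by rewrite mule0.
  rewrite -!EFinB -EFinM gtr0_norm//; congr EFin.
  by field.
Qed.

Lemma integral_affine_line (al c : R) (h : R -> \bar R) : al != 0 ->
  measurable_fun [set: measurableTypeR R] h -> (forall x, 0 <= h x)%E ->
  (\int[leb]_x h (al * x + c)%R = `|al|^-1%:E * \int[leb]_x h x)%E.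
Proof.
move=> al0 mh h0.
have mphi := measurable_affine_line al c.
rewrite -[in LHS](preimage_setT (fun x : measurableTypeR R => al * x + c)).
apply: (@ge0_integral_comp_scale _ _ _ _ _ leb leb
  (fun x : measurableTypeR R => al * x + c)) => //.
move=> A mA _; have E1 := lebesgue_measure_affine_preimage c al0 mA.
apply: etrans (congr1 (mule `|al|^-1%:E) (esym E1)).
by rewrite muleA -EFinM mulVf ?mul1e ?normr_eq0.
Qed.

End lebesgue_line.

Section lebesgue_space.
Context {R : realType}.
Local Notation leb := (@lebesgue_measure R).
Local Notation lam := (@lebesgue_cV R).

Lemma measurable_affine_cV n (A : 'M[R]_n) (t : 'cV[R]_n) :
  measurable_fun [set: 'cV[R]_n] (fun x : 'cV[R]_n => A *m x + t).
Proof.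
apply: measurable_fun_cVP => i; under eq_fun do rewrite mxE.
apply: measurable_funD => //; under eq_fun do rewrite mxE.
apply: measurable_sum => j.
by apply: measurable_funM => //; exact: measurable_coord.
Qed.

(** The line carries two convertible measurable structures with different
displays; Lebesgue measure lives on this one. *)
Lemma measurable_cons_cVR n :
  measurable_fun [set: (measurableTypeR R * 'cV[R]_n)%type] (@cons_cV R n).
Proof. exact: (@measurable_cons_cV R n). Qed.

Lemma measurable_mulmx_cV n (A : 'M[R]_n) :
  measurable_fun [set: 'cV[R]_n] (mulmx A : 'cV[R]_n -> 'cV[R]_n).
Proof.
rewrite (_ : mulmx A = (fun x => A *m x + 0)); first exact: measurable_affine_cV.
by apply/funext => x; rewrite addr0.
Qed.

Section fubini_cons.
Variables (n : nat) (h : 'cV[R]_n.+1 -> \bar R).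
Hypotheses (mh : measurable_fun setT h) (h0 : forall x, (0 <= h x)%E).
Let hc : measurableTypeR R * 'cV[R]_n -> \bar R := fun p => h (cons_cV p).

Let mhc : measurable_fun setT hc.
Proof. exact: measurableT_comp mh (@measurable_cons_cVR n). Qed.

Let hc0 p : (0 <= hc p)%E. Proof. exact: h0. Qed.

Lemma integral_cons_cV :
  (\int[lam n.+1]_v h v = \int[leb \x lam n]_p hc p)%E.
Proof.
have := @ge0_integral_pushforward _ _ _ _ R _ (@measurable_cons_cVR n)
  (leb \x lam n)%E setT h measurableT mh (fun x _ => h0 x).
by rewrite preimage_setT.
Qed.

Lemma integral_cons_cV12 :
  (\int[lam n.+1]_v h v = \int[leb]_x \int[lam n]_v h (cons_cV (x, v)))%E.
Proof. by rewrite integral_cons_cV fubini_tonelli1. Qed.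

Lemma integral_cons_cV21 :
  (\int[lam n.+1]_v h v = \int[lam n]_v \int[leb]_x h (cons_cV (x, v)))%E.
Proof. by rewrite integral_cons_cV fubini_tonelli2. Qed.

Lemma measurable_integral_cons_cV2 :
  measurable_fun setT (fun v => \int[leb]_x h (cons_cV (x, v)))%E.
Proof. exact: (@measurable_fun_fubini_tonelli_G _ _ _ _ R leb hc). Qed.

Lemma measurable_cons_cV_section1 v :
  measurable_fun [set: measurableTypeR R] (fun x => h (cons_cV (x, v))).
Proof. exact: (measurable_fun_pair1 v mhc). Qed.

Lemma measurable_cons_cV_section2 x :
  measurable_fun setT (fun v => h (cons_cV (x, v))).
Proof. exact: (measurable_fun_pair2 x mhc). Qed.

End fubini_cons.

(** Stated for integrals rather than for measures of sets, so that Tonelli's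
theorem applies to it directly and compositions are immediate. *)
Definition scales n (phi : 'cV[R]_n -> 'cV[R]_n) (c : R) :=
  forall h : 'cV[R]_n -> \bar R, measurable_fun setT h ->
    (forall x, 0 <= h x)%E ->
    (\int[lam n]_x h (phi x) = c%:E * \int[lam n]_x h x)%E.

Lemma scales_comp n (phi psi : 'cV[R]_n -> 'cV[R]_n) c c' :
  measurable_fun setT phi ->
  scales phi c -> scales psi c' -> scales (phi \o psi) (c * c').
Proof.
move=> mphi sphi spsi h mh h0.
rewrite /= (spsi (h \o phi)) ?sphi ?muleA -?EFinM 1?mulrC//.
- exact: measurableT_comp.
- by move=> x; exact: h0.
Qed.

Lemma scales_shift n (t : 'cV[R]_n) : scales (+%R^~ t) 1.
Proof.
elim: n t => [|n ih] t h mh h0.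
  rewrite mul1e; apply: eq_integral => x _.
  by congr h; apply/colP => -[].
have mt : measurable_fun setT (fun x : 'cV[R]_n.+1 => x + t).
  by under eq_fun do rewrite -[X in X + _]mul1mx; exact: measurable_affine_cV.
pose p := uncons_cV t.
have addE x v : cons_cV (x, v) + t = cons_cV (x + p.1, v + p.2).
  apply/colP => i; rewrite mxE !cons_cVE.
  by case: unliftP => [j|] ->/=; rewrite ?mxE.
rewrite integral_cons_cV12//; last exact: measurableT_comp mh mt.
rewrite integral_cons_cV12// mul1e.
under eq_integral => x _ do under eq_integral => v _ do rewrite addE.
under eq_integral => x _.
  rewrite (ih p.2 (fun v => h (cons_cV (x + p.1, v))))//; last first.
    exact: measurable_cons_cV_section2.
  rewrite mul1e; over.
pose g x := (\int[lam n]_v h (cons_cV (x, v)))%E.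
transitivity (\int[leb]_x g (1 * x + p.1)%R)%E.
  by apply: eq_integral => x _; rewrite mul1r.
rewrite integral_affine_line ?oner_neq0 ?normr1 ?invr1 ?mul1e//.
  apply: (@measurable_fun_fubini_tonelli_F _ _ _ _ _ (lam n)
    (fun q : measurableTypeR R * 'cV[R]_n => h (cons_cV q))) => //.
  exact: measurableT_comp mh (@measurable_cons_cVR n).
by move=> x; exact: integral_ge0.
Qed.

(** Integrating the first coordinate first, the inner integral is over an affine
map of the line; the outer one is then a substitution by [N]. *)
Lemma scales_ublock n (al : R) (u : 'rV[R]_n) (N : 'M[R]_n) c :
  al != 0 -> scales (mulmx N) c ->
  scales (mulmx (block_mx al%:M u 0 N : 'M[R]_(1 + n))) (`|al|^-1 * c).
Proof.
move=> al0 sN h mh h0.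
have mulE x v : (block_mx al%:M u 0 N : 'M[R]_(1 + n)) *m cons_cV (x, v) =
    cons_cV (al * x + (u *m v) ord0 ord0, N *m v).
  rewrite /cons_cV /= mul_block_col mul0mx add0r mul_scalar_mx; congr col_mx.
  by apply/matrixP => i j; rewrite !ord1 !mxE.
rewrite integral_cons_cV21//; last first.
  apply: measurableT_comp mh _; exact: measurable_mulmx_cV.
rewrite integral_cons_cV21//.
under eq_integral => v _.
  under eq_integral => x _ do rewrite mulE.
  rewrite (@integral_affine_line _ al _ (fun x => h (cons_cV (x, N *m v))))//.
    over.
  exact: measurable_cons_cV_section1.
pose g v := (\int[leb]_x h (cons_cV (x, v)))%E.
have g0 v : (0 <= g v)%E by exact: integral_ge0.
have mg : measurable_fun setT g := measurable_integral_cons_cV2 mh h0.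
rewrite (@ge0_integralZl_EFin _ _ R (lam n) setT measurableT (fun v => g (N *m v))).
- by rewrite EFinM -muleA (sN g mg g0).
- by move=> v _; exact: g0.
- exact: measurableT_comp mg (measurable_mulmx_cV N).
- by rewrite invr_ge0.
Qed.

(** Integrating the last coordinates first, the inner substitution is a
translation. *)
Lemma scales_lblock n (w : 'cV[R]_n) :
  scales (mulmx (block_mx 1%:M 0 w 1%:M : 'M[R]_(1 + n))) 1.
Proof.
move=> h mh h0.
have mulE x v : (block_mx 1%:M 0 w 1%:M : 'M[R]_(1 + n)) *m cons_cV (x, v) =
    cons_cV (x, v + x *: w).
  rewrite /cons_cV /= mul_block_col !mul1mx mul0mx addr0; congr col_mx.
  rewrite addrC; congr (_ + _); apply/matrixP => i j.
  by rewrite !mxE big_ord1 !mxE !ord1 mulrC.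
rewrite integral_cons_cV12//; last first.
  apply: measurableT_comp mh _; exact: measurable_mulmx_cV.
rewrite integral_cons_cV12// mul1e; apply: eq_integral => x _.
under eq_integral => v _ do rewrite mulE.
rewrite (scales_shift (x *: w) (h := fun v => h (cons_cV (x, v))))// ?mul1e//.
exact: measurable_cons_cV_section2.
Qed.

Lemma scales_mulmx_mul n (A A' : 'M[R]_n) :
  scales (mulmx A) `|\det A|^-1 -> scales (mulmx A') `|\det A'|^-1 ->
  scales (mulmx (A *m A')) `|\det (A *m A')|^-1.
Proof.
move=> sA sA'; rewrite det_mulmx normrM invfM.
rewrite (_ : mulmx _ = mulmx A \o mulmx A'); last first.
  by apply/funext => x; rewrite /= mulmxA.
by apply: scales_comp => //; exact: measurable_mulmx_cV.
Qed.

(** Elimination of the first coordinate writes an invertible matrix as a lower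
unipotent block matrix times an upper block matrix, after one transvection if
the top-left entry vanishes.  The lower right block is handled by induction, so
neither permutations nor a full triangular decomposition are needed. *)
Theorem scales_mulmx n (A : 'M[R]_n) :
  A \in unitmx -> scales (mulmx A) `|\det A|^-1.
Proof.
elim: n A => [|n ih] A uA.
  move=> h mh h0; rewrite det_mx00 normr1 invr1 mul1e.
  by apply: eq_integral => x _; congr h; apply/colP => -[].
pose A' : 'M[R]_(1 + n) := A.
have pivot (C : 'M[R]_(1 + n)) : C \in unitmx -> C ord0 ord0 != 0 ->
    scales (mulmx C) `|\det C|^-1.
  move=> uC; set al := C ord0 ord0 => al0.
  pose u := ursubmx C; pose w := dlsubmx C; pose N := drsubmx C.
  have ulE : ulsubmx C = al%:M.
    apply/matrixP => i j; rewrite !ord1 [RHS]mxE eqxx mulr1n !mxE.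
    by congr (C _ _); exact/val_inj.
  have CE : C = block_mx 1%:M 0 (al^-1 *: w) 1%:M *m
                block_mx al%:M u 0 (N - (al^-1 *: w) *m u).
    rewrite mulmx_block !mul1mx !mul0mx !addr0.
    rewrite mul_mx_scalar scalerA mulfV// scale1r [X in block_mx _ _ _ X]addrC subrK.
    by rewrite -ulE submxK.
  have dU : \det (block_mx al%:M u 0 (N - (al^-1 *: w) *m u)) =
      al * \det (N - (al^-1 *: w) *m u).
    by rewrite (@det_ublock _ 1 n) det_scalar1.
  have dC : \det C = al * \det (N - (al^-1 *: w) *m u).
    rewrite CE det_mulmx (@det_lblock _ 1 n) !det1 !mul1r.
    exact: dU.
  rewrite CE; apply: scales_mulmx_mul.
    rewrite (@det_lblock _ 1 n) !det1 mulr1 normr1 invr1; exact: scales_lblock.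
  rewrite dU normrM invfM; apply: scales_ublock => //; apply: ih.
  rewrite unitmxE unitfE; move: uC; rewrite unitmxE unitfE dC.
  by rewrite mulf_eq0 negb_or => /andP[].
have [a0|a0] := eqVneq (A' ord0 ord0) 0; last exact: pivot.
(* The pivot vanishes, so invertibility gives a nonzero entry below it. *)
have [j wj] : exists j : 'I_n, dlsubmx A' j ord0 != 0.
  apply/existsP; apply: contraLR uA => /existsPn w0.
  rewrite unitmxE unitfE negbK.
  rewrite (expand_det_col A ord0) big1// => i _.
  have [j ->|->] := unliftP ord0 i; last by rewrite [A _ _]a0 mul0r.
  have := w0 j; rewrite negbK 2!mxE => /eqP e.
  by rewrite (_ : A _ _ = 0) ?mul0r// -[RHS]e; congr (A _ _); exact/val_inj.
pose T (s : R) : 'M[R]_(1 + n) := block_mx 1%:M (s *: delta_mx ord0 j) 0 1%:M.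
have TT s s' : T s *m T s' = T (s + s').
  rewrite /T mulmx_block !mul1mx !mul0mx !mulmx0 !mulmx1 !addr0 !add0r.
  by rewrite -scalerDl addrC.
have T0 : T 0 = 1%:M by rewrite /T scale0r -scalar_mx_block.
have dT s : \det (T s) = 1 by rewrite /T (@det_ublock _ 1 n) !det1 mulr1.
have sT s : scales (mulmx (T s)) `|\det (T s)|^-1.
  rewrite dT normr1 invr1.
  have := @scales_ublock n 1 (s *: delta_mx ord0 j) 1%:M 1 (oner_neq0 _).
  rewrite normr1 invr1 mulr1; apply.
  move=> h mh h0; rewrite mul1e; apply: eq_integral => x _.
  by rewrite mul1mx.
have -> : A = T (-1) *m (T 1 *m A') by rewrite mulmxA TT addNr T0 mul1mx.
apply: scales_mulmx_mul => //; apply: pivot.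
  by rewrite unitmxE det_mulmx dT mul1r -unitmxE.
rewrite (_ : (T 1 *m A') ord0 ord0 = dlsubmx A' j ord0)//.
have -> : T 1 *m A' = block_mx (ulsubmx A' + delta_mx ord0 j *m dlsubmx A')
    (ursubmx A' + delta_mx ord0 j *m drsubmx A') (dlsubmx A') (drsubmx A').
  rewrite -[X in _ *m X]submxK /T mulmx_block.
  by rewrite !mul1mx !mul0mx !add0r scale1r.
rewrite (_ : ord0 = lshift n (ord0 : 'I_1) :> 'I_(1 + n)); last exact/val_inj.
rewrite block_mxEul mxE -rowE [row _ _ _ _]mxE.
rewrite (_ : ulsubmx A' ord0 ord0 = 0) ?add0r// -a0 !mxE.
by congr (A' _ _); exact/val_inj.
Qed.

End lebesgue_space.

Section completed_lebesgue.
Context {R : realType} {d : nat}.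
Local Notation V := 'cV[R]_d.
Local Notation lam := (@lebesgue_cV R d).
Local Notation LT := (lebesgueT R d).
Local Notation m_d := (lebesgue_measureT R d).
Implicit Types (A : 'M[R]_d) (t : V).

Lemma lebesgue_cV_affine_preimage A t (E : set V) : A \in unitmx ->
  measurable E ->
  lam ((fun x => A *m x + t) @^-1` E) = (`|\det A|^-1%:E * lam E)%E.
Proof.
move=> uA mE.
have s1 : scales (+%R^~ t \o mulmx A) (1 * `|\det A|^-1).
  apply: scales_comp; [|exact: scales_shift|exact: scales_mulmx].
  rewrite (_ : +%R^~ t = fun x => 1%:M *m x + t); first exact: measurable_affine_cV.
  by apply/funext => x; rewrite mul1mx.
have mphi := measurable_affine_cV A t.
have mE1 : measurable_fun setT (EFin \o \1_E : V -> \bar R).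
  by apply/measurable_EFinP; exact: measurable_indic.
have H := s1 (EFin \o \1_E) mE1 (fun x => ltac:(by rewrite lee_fin)).
rewrite mul1r in H; rewrite -[E in RHS]setIT -integral_indic// -H.
rewrite (_ : (fun x => _) = EFin \o \1_((fun x => A *m x + t) @^-1` E))//.
rewrite [RHS]integral_indic ?setIT//.
by rewrite -[X in measurable X]setTI; exact: mphi.
Qed.

(** Preimages of the sets of a Borel cover of [E] cover the preimage of [E]. *)
Lemma le_lebesgueT_affine_preimage A t (E : set V) : A \in unitmx ->
  (m_d ((fun x => A *m x + t)%R @^-1` E) <= `|\det A|^-1%:E * m_d E)%E.
Proof.
move=> uA.
have d0 : 0 < `|\det A|^-1 :> R.
  by rewrite invr_gt0 normr_gt0 -unitfE -unitmxE.
rewrite -lee_pdivrMl//; apply: le_ereal_inf_tmp => _ [F [mF EF] <-].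
rewrite lee_pdivrMl// -nneseriesZl//.
rewrite (eq_eseriesr (fun k _ => esym (lebesgue_cV_affine_preimage t uA (mF k)))).
apply: ereal_inf_lbound; eexists; last reflexivity.
split.
  move=> k; rewrite -[X in measurable X]setTI.
  exact: (measurable_affine_cV A t) (mF k).
by move=> x /EF[k _ Fk]; exists k.
Qed.

Lemma affine_inverse_l A t : A \in unitmx ->
  cancel (fun x : V => A *m x + t) (fun y : V => invmx A *m y + - (invmx A *m t)).
Proof. by move=> uA x; rewrite mulmxDr mulKmx// addrK. Qed.

Lemma affine_inverse_r A t : A \in unitmx ->
  cancel (fun y : V => invmx A *m y + - (invmx A *m t)) (fun x : V => A *m x + t).
Proof. by move=> uA x; rewrite mulmxDr mulmxN !mulKVmx// subrK. Qed.

(** This holds for every set, measurable or not: the other inequality is the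
previous one for the inverse map.  It therefore transports the Caratheodory
criterion. *)
Lemma lebesgueT_affine_preimage A t (E : set V) : A \in unitmx ->
  (m_d ((fun x => A *m x + t)%R @^-1` E) = `|\det A|^-1%:E * m_d E)%E.
Proof.
move=> uA; apply/eqP; rewrite eq_le le_lebesgueT_affine_preimage//=.
have d0 : 0 < `|\det A| :> R by rewrite normr_gt0 -unitfE -unitmxE.
set phi := fun x => _.
have uA' : invmx A \in unitmx by rewrite unitmx_inv.
have := le_lebesgueT_affine_preimage (- (invmx A *m t)) (phi @^-1` E) uA'.
rewrite -comp_preimage (_ : phi \o _ = id); last first.
  by apply/funext => x; exact: affine_inverse_r.
rewrite preimage_id det_inv normfV invrK => H.
by rewrite lee_pdivrMl.
Qed.

Lemma measurable_affine_lebesgueT A t : A \in unitmx ->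
  measurable_fun [set: LT] (fun x : V => A *m x + t : LT).
Proof.
move=> uA _ Y mY; rewrite setTI; set phi := fun x => _.
have {}mY : (lam^*)%mu.-caratheodory Y := mY.
suff : (lam^*)%mu.-caratheodory (phi @^-1` Y) by [].
move=> X.
pose X' := (fun y : V => invmx A *m y + - (invmx A *m t)) @^-1` X.
have XE : X = phi @^-1` X'.
  rewrite /X' -comp_preimage (_ : _ \o phi = id) ?preimage_id//.
  by apply/funext => x; exact: affine_inverse_l.
rewrite XE preimage_setC -!preimage_setI.
have E Z : (lam^*)%mu (phi @^-1` Z) = (`|\det A|^-1%:E * (lam^*)%mu Z)%E.
  exact: lebesgueT_affine_preimage.
by rewrite !E -ge0_muleDr ?outer_measure_ge0// mY.
Qed.

Lemma measurable_lebesgueT (E : set V) : measurable E -> measurable (E : set LT).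
Proof. by move=> mE; exact: caratheodory_measurable_mu_ext. Qed.

Lemma measurable_id_lebesgueT : measurable_fun [set: LT] (id : LT -> V).
Proof. by move=> _ Y mY; rewrite setTI preimage_id; exact: measurable_lebesgueT. Qed.

Lemma ge0_integral_affine A t (D : set V) (h : V -> \bar R) : A \in unitmx ->
  measurable (D : set LT) -> measurable_fun (D : set LT) h ->
  (forall x, D x -> (0 <= h x)%E) ->
  (\int[m_d]_(x in (fun x => A *m x + t)%R @^-1` D) h (A *m x + t)%R =
   `|\det A|^-1%:E * \int[m_d]_(x in D) h x)%E.
Proof.
move=> uA mD mh h0.
apply: (@ge0_integral_comp_scale _ _ LT LT R m_d m_d (fun x : V => A *m x + t)).
- exact: measurable_affine_lebesgueT.
- by rewrite invr_ge0.
- exact: mD.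
- by move=> E mE _; exact: lebesgueT_affine_preimage.
- exact: mh.
- exact: h0.
Qed.

End completed_lebesgue.


(** * Borel sets and continuous functions on R^d *)

Section borel_cV.
Context {R : realType} {d : nat}.
Local Notation V := 'cV[R]_d.

Lemma measurable_box (r : R) : measurable (box r : set V).
Proof.
rewrite (_ : box r = \bigcap_(i in [set: 'I_d])
    ((fun v : V => v i ord0) @^-1` `[- r, r]%classic)); last first.
  apply/seteqP; split => x.
    by move=> xr i _ /=; rewrite in_itv/= -ler_norml; exact: xr.
  by move=> xr i; have := xr i I; rewrite /= in_itv/= -ler_norml.
apply: fin_bigcap_measurable => // i _.
by rewrite -[X in measurable X]setTI; exact: measurable_coord.
Qed.

Lemma measurable_cV_ball (x : V) (e : R) : measurable (ball x e : set V).
Proof.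
have [e0|e0] := ltP 0 e; last first.
  rewrite (_ : ball x e = set0)//; apply/seteqP; split=> y//= [e0'].
  by rewrite ltNge e0 in e0'.
rewrite (_ : ball x e = \bigcap_(i in [set: 'I_d])
    ((fun v : V => v i ord0) @^-1` ball (x i ord0) e)); last first.
  apply/seteqP; split => y.
    by move=> [_ xy] i _ /=; exact: xy.
  by move=> xy; split=> // i j; rewrite (ord1 j); exact: xy.
apply: fin_bigcap_measurable => // i _.
rewrite -[X in measurable X]setTI.
by apply: measurable_coord => //; exact: measurable_ball.
Qed.

(** An open set is a countable union of balls with rational centres and radii,
and balls are finite intersections of coordinate slabs. *)
Lemma measurable_open_cV (U : set V) : open U -> measurable U.
Proof.
move=> oU.
pose P (p : 'cV[rat]_d * rat) := ball (map_mx ratr p.1 : V) (ratr p.2 : R).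
rewrite (_ : U = \bigcup_p if `[< P p `<=` U >] then P p else set0); last first.
  apply/seteqP; split=> [x Ux|x [p _]]; last by case: asboolP => // pU /pU.
  have /nbhs_ballP[e /= e0 xeU] : nbhs x U by exact: open_nbhs_nbhs.
  have [r] := rat_in_itvoo (divr_gt0 e0 (ltr0Sn R 1)).
  rewrite in_itv/= => /andP[r0 re].
  have [q xq] : exists q : 'I_d -> rat, forall i,
      ratr (q i) \in `](x i ord0), (x i ord0 + ratr r)[.
    have H i : exists q : rat, ratr q \in `](x i ord0), (x i ord0 + ratr r)[.
      by apply: rat_in_itvoo; rewrite ltrDl.
    by have [q hq] := choice H; exists q.
  pose p : 'cV[rat]_d * rat := (\col_i q i, r).
  have px : ball (map_mx ratr p.1 : V) (ratr r) x.
    split=> // i j; rewrite (ord1 j) 2!mxE /ball/=.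
    have := xq i; rewrite in_itv/= => /andP[q1 q2].
    by rewrite gtr0_norm ?subr_gt0// ltrBlDl.
  exists p => //; case: asboolP => [//|]; case => y py; apply: xeU.
  apply: (@le_ball _ _ _ (ratr r + ratr r)).
    by rewrite [e]splitr; apply: lerD; exact: ltW.
  exact: (ball_triangle (ball_sym px) py).
apply: countable_bigcupT_measurable; first exact: countableP.
by move=> p; case: ifP => // _; exact: measurable_cV_ball.
Qed.

Lemma measurable_fun_continuous_cV (g : V -> R) :
  continuous g -> measurable_fun setT g.
Proof.
move=> cg; apply: (measurability (@RGenOpens.G R) (RGenOpens.measurableE R)).
move=> _ [_ [a [b ->]] <-].
rewrite setTI; apply: measurable_open_cV.
by apply: open_comp => // x _; exact: cg.
Qed.

End borel_cV.

Section continuity.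
Context {R : realType} {d : nat}.
Local Notation V := 'cV[R]_d.

Lemma bounded_set_box (S : set V) : bounded_set S -> exists r, S `<=` box r.
Proof.
move=> [K [_ HK]]; exists (K + 1) => x Sx i.
apply: le_trans (HK (K + 1) _ x Sx); last by rewrite ltrDl.
rewrite [leRHS](_ : _ = mx_norm x)// mx_normrE.
exact: (le_bigmax _ (fun ij : 'I_d * 'I_1 => `|x ij.1 ij.2|) (i, ord0)).
Qed.

(** Transposition carries a product of segments, which is compact, onto the
box. *)
Lemma compact_box (r : R) : compact (box r : set V).
Proof.
have -> : box r = (trmx : 'rV[R]_d -> V) @`
    [set v : 'rV[R]_d | forall i, `[- r, r]%classic (v ord0 i)].
  apply/seteqP; split => [x xr|_ [v vr <-] i].
    exists (x^T); last by rewrite trmxK.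
    by move=> i /=; rewrite mxE in_itv/= -ler_norml; exact: xr.
  by have := vr i; rewrite /= in_itv/= mxE -ler_norml.
apply: continuous_compact; last first.
  by apply: (@rV_compact _ _ (fun=> `[- r, r]%classic)) => i; exact: segment_compact.
apply: continuous_subspaceT => v U /nbhs_ballP[e /= e0 eU].
apply/nbhs_ballP; exists e => //= w [_ vw]; apply: eU; split => // i j.
by rewrite !mxE; exact: vw.
Qed.

Lemma continuous_bounded_box (g : V -> R) (r : R) : continuous g ->
  exists K, forall x, box r x -> g x <= K.
Proof.
move=> cg.
have : compact (g @` box r).
  by apply: continuous_compact; [exact: continuous_subspaceT|exact: compact_box].
move=> /compact_bounded[K [_ HK]]; exists (K + 1) => x xr.
apply: le_trans (ler_norm _) _.
by apply: (HK (K + 1)); [rewrite ltrDl|exists x].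
Qed.

(** Compactness is used through near-coverings, so that the perturbed point
[x + v] need not lie in the box. *)
Lemma uniform_continuous_box (g : V -> R) (r e : R) : continuous g -> 0 < e ->
  exists2 del, 0 < del & forall x v, box r x -> box del v ->
    `|g x - g (x + v)| <= e.
Proof.
move=> cg e0.
have H : near_covering (box r : set V).
  by apply/compact_near_coveringP; exact: compact_box.
have loc (x : V) : box r x ->
    \forall x' \near x & v \near (0 : V), `|g x' - g (x' + v)| <= e.
  move=> _.
  have c1 : z.1 @[z --> filter_prod (nbhs x) (nbhs (0 : V))] --> x by exact: cvg_fst.
  have c2 : z.2 @[z --> filter_prod (nbhs x) (nbhs (0 : V))] --> (0 : V).
    exact: cvg_snd.
  have c0 : g z.1 - g (z.1 + z.2) @[z --> filter_prod (nbhs x) (nbhs (0 : V))] -->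
      g x - g (x + 0).
    apply: cvgB; first exact: cvg_comp c1 (cg x).
    exact: cvg_comp (cvgD c1 c2) (cg (x + 0)).
  rewrite addr0 subrr in c0.
  by move/cvgr0Pnorm_le : c0 => /(_ e e0).
have N : nbhs (0 : V) [set v | box r `<=` (fun x => `|g x - g (x + v)| <= e)].
  exact: (H V (nbhs (0 : V)) (fun v x => `|g x - g (x + v)| <= e) _ loc).
have /nbhs_ballP[del /= del0 Hdel] := N.
(* Halved because boxes are closed and balls are open. *)
exists (del / 2); first by rewrite divr_gt0.
move=> x v xr vd; apply: Hdel xr; split => // i j; rewrite (ord1 j).
rewrite /ball/= mxE sub0r normrN; apply: le_lt_trans (vd i) _.
by rewrite ltr_pdivrMr// ltr_pMr// ltr1n.
Qed.

(** Used for the real and the imaginary part. *)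
Lemma continuous_lip_comp (f : V -> R[i]) (phi : R[i] -> R) :
  continuous (f : V -> R[i]^o) ->
  (forall z w, `|phi z - phi w| <= normc (z - w)) -> continuous (phi \o f).
Proof.
move=> cf lip x.
have F := @nbhs_pfilter V x.
apply/(cvgrPdist_lt (F := nbhs x)) => e e0.
have /(cvgrPdist_lt (F := nbhs x))/(_ e%:C) := cf x.
rewrite ltcR => /(_ e0); apply: filterS => y.
by rewrite /= ltcR => /le_lt_trans; apply; exact: lip.
Qed.

Lemma Re_lip (z w : R[i]) : `|complex.Re z - complex.Re w| <= normc (z - w).
Proof.
case: z w => [a b] [c e] /=; rewrite -sqrtr_sqr ler_sqrt ?lerDl ?sqr_ge0//.
by rewrite addr_ge0// sqr_ge0.
Qed.

Lemma Im_lip (z w : R[i]) : `|complex.Im z - complex.Im w| <= normc (z - w).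
Proof.
case: z w => [a b] [c e] /=; rewrite -sqrtr_sqr ler_sqrt ?lerDr ?sqr_ge0//.
by rewrite addr_ge0// sqr_ge0.
Qed.

End continuity.

(** * Complex-valued functions and exponentials *)

Section complex_measurable.
Context d (T : measurableType d) (R : realType).
Implicit Types (f g : T -> R[i]) (D : set T).

Definition Cmeasurable_fun D f :=
  measurable_fun D (fun x => complex.Re (f x)) /\
  measurable_fun D (fun x => complex.Im (f x)).

Lemma Cmeasurable_funM D f g : Cmeasurable_fun D f -> Cmeasurable_fun D g ->
  Cmeasurable_fun D (fun x => f x * g x).
Proof.
move=> [f1 f2] [g1 g2].
have E x : f x * g x =
    (complex.Re (f x) * complex.Re (g x) - complex.Im (f x) * complex.Im (g x)) +i*
    (complex.Re (f x) * complex.Im (g x) + complex.Im (f x) * complex.Re (g x)).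
  by case: (f x) => a b; case: (g x).
split; under eq_fun do rewrite E /=.
  by apply: measurable_funB; exact: measurable_funM.
by apply: measurable_funD; exact: measurable_funM.
Qed.

Lemma ReD (z w : R[i]) : complex.Re (z + w) = complex.Re z + complex.Re w.
Proof. by case: z => a b; case: w. Qed.

Lemma ImD (z w : R[i]) : complex.Im (z + w) = complex.Im z + complex.Im w.
Proof. by case: z => a b; case: w. Qed.

Lemma Re_sum I (s : seq I) (F : I -> R[i]) :
  complex.Re (\sum_(i <- s) F i) = \sum_(i <- s) complex.Re (F i).
Proof. by apply: (big_morph _ ReD). Qed.

Lemma Im_sum I (s : seq I) (F : I -> R[i]) :
  complex.Im (\sum_(i <- s) F i) = \sum_(i <- s) complex.Im (F i).
Proof. by apply: (big_morph _ ImD). Qed.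

Lemma Cmeasurable_fun_sum D (I : eqType) (s : seq I) (F : I -> T -> R[i]) :
  (forall i, i \in s -> Cmeasurable_fun D (F i)) ->
  Cmeasurable_fun D (fun x => \sum_(i <- s) F i x).
Proof.
(* Indices outside [s] are given the zero function. *)
wlog mF : F / forall i, Cmeasurable_fun D (F i).
  move=> H mF; pose F' i := if i \in s then F i else fun=> 0.
  rewrite (_ : (fun x => _) = fun x => \sum_(i <- s) F' i x).
    have mF' i : Cmeasurable_fun D (F' i).
      rewrite /F'; case: ifP => [/mF //|_].
      by split; exact: measurable_cst.
    exact: H.
  by apply/funext => x; apply: eq_big_seq => i is_; rewrite /F' is_.
move=> _; split; [under eq_fun do rewrite Re_sum|under eq_fun do rewrite Im_sum];
  by apply: measurable_sum => i; case: (mF i).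
Qed.

Lemma Cmeasurable_cst D z : Cmeasurable_fun D (fun=> z).
Proof. by split; exact: measurable_cst. Qed.

Lemma Cmeasurable_real D (h : T -> R) : measurable_fun D h ->
  Cmeasurable_fun D (fun x => (h x)%:C).
Proof. by move=> mh; split => //=; exact: measurable_cst. Qed.

Lemma Cmeasurable_conjc D f : Cmeasurable_fun D f ->
  Cmeasurable_fun D (fun x => (f x)^*%C).
Proof.
move=> [f1 f2]; split.
  rewrite (_ : (fun x => _) = (fun x => complex.Re (f x)))//.
  by apply/funext => x; case: (f x).
rewrite (_ : (fun x => _) = (fun x => - complex.Im (f x))); last first.
  by apply/funext => x; case: (f x).
exact: measurableT_comp.
Qed.

Lemma normc_sqr (z : R[i]) : normc z ^+ 2 = complex.Re z ^+ 2 + complex.Im z ^+ 2.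
Proof. by case: z => a b; rewrite sqr_sqrtr// addr_ge0// sqr_ge0. Qed.

Lemma normc_conj (z : R[i]) : normc z^*%C = normc z.
Proof. by case: z => x y /=; rewrite sqrrN. Qed.

Lemma conjcM (z w : R[i]) : (z * w)^*%C = z^*%C * w^*%C.
Proof. exact: rmorphM. Qed.

Lemma conjc_sum I (s : seq I) (F : I -> R[i]) :
  (\sum_(i <- s) F i)^*%C = \sum_(i <- s) (F i)^*%C.
Proof. exact: rmorph_sum. Qed.

Lemma normc_sqr_conj (z : R[i]) : (normc z ^+ 2)%:C = z * z^*%C.
Proof.
rewrite normc_sqr; case: z => a b /=; apply/eqP; rewrite eq_complex/=.
by apply/andP; split; apply/eqP; ring.
Qed.

Lemma measurable_normc_sqr D f : Cmeasurable_fun D f ->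
  measurable_fun D (fun x => normc (f x) ^+ 2).
Proof.
move=> [f1 f2]; under eq_fun do rewrite normc_sqr.
by apply: measurable_funD; exact: measurable_funX.
Qed.

Lemma measurable_normc_sqr_EFin D f : Cmeasurable_fun D f ->
  measurable_fun D (fun x => (normc (f x) ^+ 2)%:E).
Proof. by move=> mf; apply/measurable_EFinP; exact: measurable_normc_sqr. Qed.

Variable m : {measure set T -> \bar R}.

Definition Cintegrable D f :=
  m.-integrable D (EFin \o (fun x => complex.Re (f x))) /\
  m.-integrable D (EFin \o (fun x => complex.Im (f x))).

Lemma sqnorm2_ge0 D f : (0 <= sqnorm2 m D f)%E.
Proof. by apply: integral_ge0 => x _; rewrite lee_fin sqr_ge0. Qed.

(** On a set of finite measure, [|r| <= 1 + r^2]. *)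
Lemma L2_Cintegrable D f : measurable D -> (m D < +oo)%E -> L2 m D f ->
  Cintegrable D f.
Proof.
move=> mD fD [f1 f2 fin].
have mN : measurable_fun D (fun x => (normc (f x) ^+ 2)%:E).
  exact: measurable_normc_sqr_EFin.
have i2 : m.-integrable D (fun x => (1 + normc (f x) ^+ 2)%:E).
  under eq_fun do rewrite EFinD.
  apply: integrableD => //.
    apply/integrableP; split; first exact: measurable_cst.
    by under eq_integral do rewrite /= normr1; rewrite integral_cst// mul1e.
  apply/integrableP; split => //; apply: le_lt_trans fin.
  by under eq_integral do rewrite gee0_abs ?lee_fin ?sqr_ge0//.
have le1 (r : R) : `|r| <= 1 + r ^+ 2.
  by rewrite -[r ^+ 2]real_normK ?num_real//; have := normr_ge0 r; nra.
split; apply: (le_integrable mD _ _ i2); do ?exact/measurable_EFinP; move=> x _ /=.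
  rewrite lee_fin (le_trans (le1 _))// [leRHS]ger0_norm ?addr_ge0 ?sqr_ge0//.
  by rewrite lerD2l normc_sqr lerDl sqr_ge0.
rewrite lee_fin (le_trans (le1 _))// [leRHS]ger0_norm ?addr_ge0 ?sqr_ge0//.
by rewrite lerD2l normc_sqr lerDr sqr_ge0.
Qed.

Lemma L2_unimodularM D u f : Cmeasurable_fun D u -> (forall x, normc (u x) = 1) ->
  L2 m D f -> L2 m D (fun x => u x * f x).
Proof.
move=> mu u1 [f1 f2 ff].
have [g1 g2] : Cmeasurable_fun D (fun x => u x * f x) by exact: Cmeasurable_funM.
split=> //; rewrite /sqnorm2.
by under eq_integral do rewrite normcM u1 mul1r.
Qed.

Lemma Cintegral_sum D (I : eqType) (s : seq I) (F : I -> T -> R[i]) :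
  measurable D -> (forall i, i \in s -> Cintegrable D (F i)) ->
  Cintegral m D (fun x => \sum_(i <- s) F i x) = \sum_(i <- s) Cintegral m D (F i).
Proof.
move=> mD.
wlog iF : F / forall i, Cintegrable D (F i).
  move=> H iF; pose F' i := if i \in s then F i else fun=> 0.
  rewrite (_ : (fun x => _) = fun x => \sum_(i <- s) F' i x).
    rewrite H; last 2 first.
    - move=> i; rewrite /F'; case: ifP => [/iF//|_].
      by split; exact: integrable0.
    - move=> i is_; rewrite /F' is_; exact: iF.
    by apply: eq_big_seq => i is_; rewrite /F' is_.
  by apply/funext => x; apply: eq_big_seq => i is_; rewrite /F' is_.
move=> _; rewrite /Cintegral.
have H (G : I -> T -> R) : (forall i, m.-integrable D (EFin \o G i)) ->
    Rintegral m D (fun x => \sum_(i <- s) G i x) = \sum_(i <- s) Rintegral m D (G i).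
  move=> iG; elim: s => [|i s ih].
    rewrite big_nil; under eq_Rintegral do rewrite big_nil.
    by rewrite /Rintegral integral0.
  rewrite big_cons -ih; under eq_Rintegral do rewrite big_cons.
  rewrite RintegralD//.
  rewrite (_ : _ \o _ = fun x => (\sum_(j <- s) (EFin \o G j) x)%E); last first.
    by apply/funext => x /=; rewrite sumEFin.
  by apply: integrable_sum => // j _; exact: iG.
have -> : Rintegral m D (fun x => complex.Re (\sum_(i <- s) F i x)) =
    \sum_(i <- s) Rintegral m D (fun x => complex.Re (F i x)).
  by under eq_Rintegral do rewrite Re_sum; apply: H => i; case: (iF i).
have -> : Rintegral m D (fun x => complex.Im (\sum_(i <- s) F i x)) =
    \sum_(i <- s) Rintegral m D (fun x => complex.Im (F i x)).
  by under eq_Rintegral do rewrite Im_sum; apply: H => i; case: (iF i).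
by apply/eqP; rewrite eq_complex/= Re_sum Im_sum !eqxx.
Qed.

Lemma sqnorm2_sum D (I : eqType) (s : seq I) (F : I -> T -> R[i]) :
  measurable D -> (forall i, i \in s -> Cmeasurable_fun D (F i)) ->
  (\int[m]_(x in D) (\sum_(i <- s) normc (F i x) ^+ 2)%:E =
   \sum_(i <- s) sqnorm2 m D (F i))%E.
Proof.
move=> mD.
wlog mF : F / forall i, Cmeasurable_fun D (F i).
  move=> H mF; pose F' i := if i \in s then F i else fun=> 0.
  rewrite (eq_integral (fun x => (\sum_(i <- s) normc (F' i x) ^+ 2)%:E)).
    rewrite H; last 2 first.
    - move=> i; rewrite /F'; case: ifP => [/mF //|_].
      by split; exact: measurable_cst.
    - move=> i is_; rewrite /F' is_; exact: mF.
    by apply: eq_big_seq => i is_; rewrite /F' is_.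
  by move=> x _; congr EFin; apply: eq_big_seq => i is_; rewrite /F' is_.
move=> _; under eq_integral do rewrite -sumEFin.
rewrite ge0_integral_sum//.
  by move=> i; exact: measurable_normc_sqr_EFin.
by move=> i x _; rewrite lee_fin sqr_ge0.
Qed.

Lemma realcM (c : R) (z : R[i]) :
  c%:C * z = (c * complex.Re z) +i* (c * complex.Im z).
Proof.
by case: z => x y; apply/eqP; rewrite eq_complex/= !mul0r subr0 addr0 !eqxx.
Qed.

Lemma CintegralZ D (c : R) f : measurable D -> Cintegrable D f ->
  Cintegral m D (fun x => c%:C * f x) = c%:C * Cintegral m D f.
Proof.
move=> mD [f1 f2]; rewrite /Cintegral realcM /=.
under eq_Rintegral do rewrite realcM/=.
under [X in _ +i* X]eq_Rintegral do rewrite realcM/=.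
by rewrite !RintegralZl.
Qed.

Lemma sqnorm2Z D (c : R) f : measurable D -> Cmeasurable_fun D f ->
  (sqnorm2 m D (fun x => c%:C * f x)%R = (c ^+ 2)%:E * sqnorm2 m D f)%E.
Proof.
move=> mD mf; rewrite /sqnorm2.
under eq_integral do rewrite normcM normc_real exprMn real_normK ?num_real// EFinM.
rewrite (ge0_integralZl_EFin m mD _ (measurable_normc_sqr_EFin mf))//.
  by move=> x _; rewrite lee_fin sqr_ge0.
exact: sqr_ge0.
Qed.

Lemma L2Z D (c : R) f : measurable D -> L2 m D f ->
  L2 m D (fun x => c%:C * f x).
Proof.
move=> mD [f1 f2 ff].
have mf : Cmeasurable_fun D f by [].
have [g1 g2] : Cmeasurable_fun D (fun x => c%:C * f x).
  by apply: Cmeasurable_funM => //; exact: Cmeasurable_cst.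
by split=> //; rewrite sqnorm2Z// lte_mul_pinfty// lee_fin sqr_ge0.
Qed.

End complex_measurable.

Section characters.
Context {R : realType} {n : nat}.
Local Notation V := 'cV[R]_n.
Implicit Types (x y l s : V).

Lemma dotvDl x y z : dotv (x + y) z = dotv x z + dotv y z :> R.
Proof. by rewrite /dotv linearD mulmxDl mxE. Qed.

Lemma dotvE x y : dotv x y = \sum_i x i ord0 * y i ord0 :> R.
Proof. by rewrite /dotv mxE; apply: eq_bigr => i _; rewrite mxE. Qed.

Lemma dotvC x y : dotv x y = dotv y x :> R.
Proof. by rewrite !dotvE; apply: eq_bigr => i _; rewrite mulrC. Qed.

Lemma dotvN x y : dotv (- x) y = - dotv x y :> R.
Proof.
by rewrite !dotvE -sumrN; apply: eq_bigr => i _; rewrite mxE mulNr.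
Qed.

Lemma dotv_mulmx (M : 'M[R]_n) x y : dotv (M^T *m x) y = dotv x (M *m y).
Proof. by rewrite /dotv trmx_mul trmxK mulmxA. Qed.

Lemma expiDl x y z : expi (x + y) z = expi x z * expi y z.
Proof.
rewrite /expi dotvDl mulrDr cosD sinD; apply/eqP; rewrite eq_complex/= eqxx/=.
by apply/eqP; ring.
Qed.

Lemma expiC x y : expi x y = expi y x.
Proof. by rewrite /expi dotvC. Qed.

Lemma expiDr x y z : expi z (x + y) = expi z x * expi z y.
Proof. by rewrite ![expi z _](expiC z) expiDl. Qed.

Lemma normc_expi x y : normc (expi x y) = 1.
Proof. by rewrite /expi /= cos2Dsin2 sqrtr1. Qed.

Lemma expiN x y : expi (- x) y = (expi x y)^*%C.
Proof. by rewrite /expi dotvN mulrN cosN sinN. Qed.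

Lemma expi_int x y : dotv x y \is a Num.int -> expi x y = 1.
Proof.
move=> /intrP[k kE]; rewrite /expi kE.
have H j : cos (2 * pi * j%:R) = 1 :> R /\ sin (2 * pi * j%:R) = 0 :> R.
  elim: j => [|j [c s]]; first by rewrite mulr0 cos0 sin0.
  rewrite -[j.+1%:R]natr1 mulrDr mulr1 cosD sinD c s.
  by rewrite [2 * _]mulrC mulr_natr cos2pi sin2pi; split; ring.
case: k {kE} => j; first by have [-> ->] := H j.
by rewrite NegzE mulrNz mulrN cosN sinN; have [-> ->] := H j.+1; rewrite oppr0.
Qed.

Lemma Cmeasurable_expi D l : Cmeasurable_fun D (expi l : V -> R[i]).
Proof.
have md : measurable_fun [set: V] (fun x => 2 * pi * dotv l x).
  apply: measurable_funM => //.
  rewrite (_ : dotv l = fun x : V => \sum_i l i ord0 * x i ord0); last first.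
    by apply/funext => x; exact: dotvE.
  apply: measurable_sum => i; apply: measurable_funM => //.
  exact: measurable_coord.
split; apply: measurable_funTS.
- exact: measurableT_comp (continuous_measurable_fun (@continuous_cos R)) md.
- exact: measurableT_comp (continuous_measurable_fun (@continuous_sin R)) md.
Qed.

End characters.

(** * Integrals over unions and affine images *)

Section ae_disjoint_union.
Local Open Scope ereal_scope.

(** Removing the null intersection from one of the sets makes them disjoint. *)
Lemma ge0_integral_setU_ae d (T : measurableType d) (R : realType)
    (m : {measure set T -> \bar R}) (E F : set T) (h : T -> \bar R) :
  measurable E -> measurable F -> m (E `&` F) = 0 ->
  measurable_fun (E `|` F) h -> (forall x, 0 <= h x) ->
  \int[m]_(x in E `|` F) h x = \int[m]_(x in E) h x + \int[m]_(x in F) h x.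
Proof.
move=> mE mF mEF mh h0.
have mhE : measurable_fun E h by apply: measurable_funS mh => //; exact: measurableU.
have -> : E `|` F = (E `\` F) `|` F by rewrite setDE setUIl [~` F `|` F]setUC setUv setIT.
rewrite ge0_integral_setU//.
- congr (_ + _); rewrite [RHS](ge0_negligible_integral (N := E `&` F))//.
    by rewrite setDIr setDv set0U.
  exact: measurableI.
- exact: measurableD.
- by rewrite setDE setUIl [~` F `|` F]setUC setUv setIT.
- by apply/disj_setPS => x [[_ nF] Fx].
Qed.

Lemma ge0_integral_bigsetU_ae d (T : measurableType d) (R : realType)
    (m : {measure set T -> \bar R}) (I : eqType) (s : seq I) (F : I -> set T)
    (h : T -> \bar R) :
  uniq s -> (forall i, measurable (F i)) ->
  (forall i j, i \in s -> j \in s -> i != j -> m (F i `&` F j) = 0) ->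
  measurable_fun (\big[setU/set0]_(i <- s) F i) h -> (forall x, 0 <= h x) ->
  \int[m]_(x in \big[setU/set0]_(i <- s) F i) h x =
  \sum_(i <- s) \int[m]_(x in F i) h x.
Proof.
move=> + mF + + h0; elim: s => [|i s ih] /=.
  by rewrite !big_nil integral_set0.
move=> /andP[is_ us] mI; rewrite !big_cons => mh.
have mU : measurable (\big[setU/set0]_(j <- s) F j) by exact: bigsetU_measurable.
rewrite ge0_integral_setU_ae// -?ih//.
- by move=> j k js ks; apply: mI; rewrite inE ?js ?ks orbT.
- by apply: measurable_funS mh; [exact: measurableU|exact: subsetUr].
- have {}mI j : j \in s -> m (F i `&` F j) = 0.
    move=> js; apply: mI; rewrite ?mem_head ?inE ?js ?orbT//.
    by apply: contraNneq is_ => ->.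
  elim: (s) mI {ih is_ us mh mU} => [|j s' ih'] mI.
    by rewrite big_nil setI0 measure0.
  rewrite big_cons setIUr.
  have mU' : measurable (\big[setU/set0]_(j <- s') F j) by exact: bigsetU_measurable.
  apply/negligibleP; first by apply: measurableU; exact: measurableI.
  apply: negligibleU; apply/negligibleP; do ?exact: measurableI.
    by apply: mI; rewrite mem_head.
  by apply: ih' => k ks; apply: mI; rewrite inE ks orbT.
Qed.

End ae_disjoint_union.

Section affine_images.
Context {R : realType} {d : nat}.
Local Notation V := 'cV[R]_d.
Local Notation LT := (lebesgueT R d).
Local Notation m_d := (lebesgue_measureT R d).

Lemma Cmeasurable_lebesgueT (D : set V) (f : V -> R[i]) :
  Cmeasurable_fun [set: V] f -> Cmeasurable_fun (D : set LT) f.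
Proof.
by move=> [f1 f2]; split; apply: measurable_funTS;
  [exact: (measurableT_comp f1 measurable_id_lebesgueT)|
   exact: (measurableT_comp f2 measurable_id_lebesgueT)].
Qed.

Lemma L2_Cmeasurable (D : set V) (f : V -> R[i]) :
  L2 m_d D f -> Cmeasurable_fun (D : set LT) f.
Proof. by case. Qed.

Variable (A : 'M[R]_d) (t : V).
Hypothesis uA : A \in unitmx.
Local Notation phi := (fun x : V => A *m x + t).
Local Notation J := (`|\det A|^-1).

(** Apply the formula for nonnegative functions to the positive and the negative
part. *)
Lemma Rintegral_affine (D : set V) (h : V -> R) : measurable (D : set LT) ->
  m_d.-integrable D (EFin \o h) ->
  Rintegral m_d (phi @^-1` D) (h \o phi) = J * Rintegral m_d D h.
Proof.
move=> mD ih; have mh := measurable_int _ ih.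
rewrite /Rintegral [in LHS]integralE [in RHS]integralE.
set p := (\int[m_d]_(x in phi @^-1` D) _)%E; set n := (X in (p - X)%E).
set p' := (\int[m_d]_(x in D) _)%E; set n' := (X in (p' - X)%E).
have -> : p = (J%:E * p')%E.
  have <- := @ge0_integral_affine R d A t D ((EFin \o h)^\+%E) uA mD
    (measurable_funepos mh) (fun x _ => funepos_ge0 _ x).
  by apply: eq_integral => x _; rewrite !funeposE.
have -> : n = (J%:E * n')%E.
  have <- := @ge0_integral_affine R d A t D ((EFin \o h)^\-%E) uA mD
    (measurable_funeneg mh) (fun x _ => funeneg_ge0 _ x).
  by apply: eq_integral => x _; rewrite !funenegE.
have p'f : p' \is a fin_num by exact: integrable_pos_fin_num.
have n'f : n' \is a fin_num by exact: integrable_neg_fin_num.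
by rewrite -(fineK p'f) -(fineK n'f) -!EFinM -!EFinB /= mulrBr.
Qed.

Lemma measurable_preimage_affine (D : set V) : measurable (D : set LT) ->
  measurable (phi @^-1` D : set LT).
Proof.
move=> mD; rewrite -[X in measurable X]setTI.
exact: (measurable_affine_lebesgueT t uA) mD.
Qed.

Lemma Cmeasurable_fun_affine (D : set V) (f : V -> R[i]) :
  measurable (D : set LT) -> Cmeasurable_fun (D : set LT) f ->
  Cmeasurable_fun (phi @^-1` D : set LT) (f \o phi).
Proof.
move=> mD [f1 f2].
have H (h : V -> R) : measurable_fun (D : set LT) h ->
    measurable_fun (phi @^-1` D : set LT) (h \o phi).
  move=> mh _ Y mY.
  exact: (measurable_preimage_affine (mh mD Y mY)).
by split; [exact: (H _ f1)|exact: (H _ f2)].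
Qed.

End affine_images.

(** * Overlap of the translates of a spectral set *)

Lemma bounded_integrable d (T : measurableType d) (R : realType)
    (m : {measure set T -> \bar R}) (D : set T) (h : T -> R) (K : R) :
  measurable D -> (m D < +oo)%E -> measurable_fun D h ->
  (forall x, D x -> `|h x| <= K) -> m.-integrable D (EFin \o h).
Proof.
move=> mD fD mh hK.
have iK : m.-integrable D (fun=> K%:E).
  apply/integrableP; split; first exact: measurable_cst.
  by rewrite integral_cst//= lte_mul_pinfty.
apply: le_integrable iK => //; first exact/measurable_EFinP.
move=> x Dx /=; rewrite lee_fin [leRHS]ger0_norm ?hK//.
exact: le_trans (normr_ge0 _) (hK _ Dx).
Qed.

Section overlap.
Context {R : realType} {d : nat}.
Local Notation V := 'cV[R]_d.
Local Notation LT := (lebesgueT R d).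
Local Notation m_d := (lebesgue_measureT R d).

Lemma shift_affine (t : V) : (fun x => x + t) = (fun x : V => 1%:M *m x + t).
Proof. by apply/funext => x; rewrite mul1mx. Qed.

Lemma measurable_shift_lebesgueT (t : V) (D : set V) : measurable (D : set LT) ->
  measurable ((fun x => x + t) @^-1` D : set LT).
Proof.
move=> mD; rewrite shift_affine.
exact: (measurable_preimage_affine t (@unitmx1 R d) mD).
Qed.

Lemma Rintegral_shift (t : V) (D : set V) (h : V -> R) : measurable (D : set LT) ->
  m_d.-integrable D (EFin \o h) ->
  Rintegral m_d ((fun x => x + t) @^-1` D) (fun x => h (x + t)) = Rintegral m_d D h.
Proof.
move=> mD ih; have := Rintegral_affine t (@unitmx1 R d) mD ih.
rewrite det1 normr1 invr1 mul1r => <-.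
by rewrite -shift_affine.
Qed.

(** The sign of [sin (pi x_i / t_i)] changes under translation by [t]; where the
sine vanishes, the sign of the cosine decides. *)
Lemma half_periods (t : V) (i : 'I_d) : t i ord0 != 0 -> exists Q : set V,
  measurable Q /\ forall x, Q (x + t) <-> ~ Q x.
Proof.
move=> ti.
pose s (x : V) := sin (pi * (x i ord0 / t i ord0)).
pose c (x : V) := cos (pi * (x i ord0 / t i ord0)).
have arg x : pi * ((x + t) i ord0 / t i ord0) = pi * (x i ord0 / t i ord0) + pi.
  by rewrite mxE; field.
have sD x : s (x + t) = - s x by rewrite /s arg sinDpi.
have cD x : c (x + t) = - c x by rewrite /c arg cosDpi.
exists [set x | 0 < s x \/ (s x = 0 /\ 0 < c x)]; split; last first.
  move=> x /=; rewrite sD cD.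
  have cs : s x = 0 -> c x != 0.
    move=> s0; apply/eqP => c0.
    have := cos2Dsin2 (pi * (x i ord0 / t i ord0)).
    by rewrite -/(s x) -/(c x) s0 c0 expr0n/= addr0 => /esym/eqP; rewrite oner_eq0.
  split=> [[s0|[s0 c0]] [s1|[s1 c1]]|]; [lra|lra|lra|lra|].
  move=> nQ; have [s0|s0|s0] := ltgtP (s x) 0.
  - by left; lra.
  - by case: nQ; left.
  - right; rewrite s0 oppr0; split=> //.
    have [c0|c0|c0] := ltgtP (c x) 0; first by lra.
      by case: nQ; right.
    by move: (cs s0); rewrite c0 eqxx.
have marg : measurable_fun [set: V] (fun x => pi * (x i ord0 / t i ord0)).
  apply: measurable_funM => //; apply: measurable_funM => //.
  exact: measurable_coord.
have ms : measurable_fun [set: V] s.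
  exact: measurableT_comp (continuous_measurable_fun (@continuous_sin R)) marg.
have mc : measurable_fun [set: V] c.
  exact: measurableT_comp (continuous_measurable_fun (@continuous_cos R)) marg.
rewrite (_ : mkset _ = s @^-1` `]0, +oo[%classic `|`
    (s @^-1` [set 0] `&` c @^-1` `]0, +oo[%classic)); last first.
  by apply/seteqP; split => x /=; rewrite !in_itv/= !andbT.
apply: measurableU; last apply: measurableI; rewrite -[X in measurable X]setTI.
- exact: ms.
- exact: ms.
- exact: mc.
Qed.

Variables (Omega Lambda : set V) (a A : R).
Hypothesis hpair : generalized_spectral_pair Omega Lambda a A.

Let mO : measurable (Omega : set LT). Proof. by case: hpair. Qed.
Let fO : (m_d Omega < +oo)%E. Proof. by case: hpair => _ /andP[]. Qed.

(** Exponentials with frequency in [Lambda] are invariant under translation by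
[t], so all the coefficients of [1_G - 1_(G+t)] vanish, and the lower frame
bound makes this function zero almost everywhere. *)
Lemma null_of_disjoint_translate (t : V) (G : set V) : dual_set Lambda t ->
  measurable (G : set LT) -> G `<=` Omega ->
  (fun x => x + t) @` G `<=` Omega -> (forall x, G x -> ~ G (x + t)) ->
  m_d G = 0%E.
Proof.
move=> tL mG GO GtO GnG.
pose G' := (fun x : V => x + - t) @^-1` G.
have mG' : measurable (G' : set LT) by exact: measurable_shift_lebesgueT.
have G'O : G' `<=` Omega.
  by move=> x Gx; apply: GtO; exists (x + - t) => //; rewrite subrK.
have fG : (m_d G < +oo)%E by apply: le_lt_trans fO; apply: le_measure => //; rewrite inE.
pose f (x : V) : R[i] := (\1_G x - \1_G' x)%:C.
have mf : Cmeasurable_fun (Omega : set LT) f.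
  apply: Cmeasurable_real; apply: measurable_funB; exact: measurable_indic.
have f1 x : normc (f x) ^+ 2 <= 1.
  rewrite /f normc_real -[leRHS](expr1n _ 2) ler_sqr ?nnegrE//.
  rewrite !indicE; case: (x \in G); case: (x \in G');
    rewrite ?subrr ?subr0 ?sub0r ?normrN ?normr1 ?normr0//.
have L2f : L2 m_d Omega f.
  case: (mf) => mf1 mf2; split => //.
  apply: le_lt_trans fO; rewrite -[leRHS]mul1e -integral_cst//.
  apply: (ge0_le_integral _ mO).
  - by move=> x _; rewrite lee_fin sqr_ge0.
  - exact: (measurable_normc_sqr_EFin mf).
  - exact: measurable_cst.
  - by move=> x _; rewrite lee_fin.
have [_ _ /andP[a0 _] fr] := hpair.
have {fr} [lo _] := fr f L2f.
have zero lam : Lambda lam ->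
    Cintegral m_d Omega (fun x => (expi lam x)^*%C * f x) = 0.
  move=> Llam.
  have key (u : V -> R) : measurable_fun (setT : set LT) u ->
      (forall x, `|u x| <= 1) -> (forall x, u (x + - t) = u x) ->
      Rintegral m_d Omega (fun x => u x * (\1_G x - \1_G' x)) = 0.
    move=> mu_ u1 ut.
    have iu (P : set V) : measurable (P : set LT) ->
        m_d.-integrable Omega (EFin \o (fun x : V => u x * \1_P x)).
      move=> mP.
      have mup : measurable_fun (Omega : set LT) (fun x : V => u x * \1_P x).
        apply: measurable_funM; last exact: measurable_indic.
        exact: measurable_funTS mu_.
      apply: (bounded_integrable (K := 1) mO fO mup).
      move=> x _; rewrite normrM -[leRHS]mulr1 ler_pM// indicE.
      by case: (_ \in _); rewrite ?normr1// normr0.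
    have restr (P : set V) : P `<=` Omega ->
        Rintegral m_d Omega (fun x => u x * \1_P x) = Rintegral m_d P u.
      move=> PO; rewrite -[in RHS](setIidr PO) Rintegral_mkcondr.
      apply: eq_Rintegral => x _; rewrite /patch indicE.
      by case: ifP; rewrite ?mulr1// mulr0.
    under eq_Rintegral do rewrite mulrBr.
    rewrite RintegralB//; [|exact: iu|exact: iu].
    rewrite !restr// -[X in X - _](Rintegral_shift (- t))//; last first.
      apply: (bounded_integrable (K := 1) mG fG); last by move=> x _.
      exact: measurable_funTS mu_.
    by under eq_Rintegral do rewrite ut; rewrite subrr.
  have eper x : expi lam (x + - t) = expi lam x.
    by rewrite expiDr (expiC lam (- t)) expiN (expi_int (tL _ Llam)) conjc1 mulr1.
  have [mR mI] := Cmeasurable_lebesgueT setT (Cmeasurable_expi setT lam).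
  have Eprod x : (expi lam x)^*%C * f x =
      (complex.Re (expi lam x) * (\1_G x - \1_G' x)) +i*
      (- complex.Im (expi lam x) * (\1_G x - \1_G' x)).
    rewrite /f /expi; apply/eqP; rewrite eq_complex/=.
    by rewrite !mulr0 subr0 add0r !eqxx.
  rewrite /Cintegral; under eq_Rintegral do rewrite Eprod/=.
  under [X in _ +i* X]eq_Rintegral do rewrite Eprod/=.
  have -> : Rintegral m_d Omega
      (fun x => complex.Re (expi lam x) * (\1_G x - \1_G' x)) = 0.
    apply: (key _ mR) => x; first exact: cos_max.
    by rewrite eper.
  have -> : Rintegral m_d Omega
      (fun x => - complex.Im (expi lam x) * (\1_G x - \1_G' x)) = 0.
    apply: (key (fun x => - complex.Im (expi lam x)) (measurableT_comp _ mI)) => //.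
      by move=> x; rewrite normrN; exact: sin_max.
    by move=> x; rewrite eper.
  by [].
have {}lo : (a%:E * sqnorm2 m_d Omega f <= 0)%E.
  apply: le_trans lo _; rewrite esum1// => lam Llam.
  by rewrite zero// normc0 expr0n.
have lG : (m_d G <= sqnorm2 m_d Omega f)%E.
  rewrite -[m_d G]mul1e -integral_cst//.
  apply: (@le_trans _ _ (\int[m_d]_(x in G) (normc (f x) ^+ 2)%:E)%E).
    apply: (ge0_le_integral _ mG).
    - by move=> x _; rewrite lee_fin.
    - exact: measurable_cst.
    - exact: (measurable_funS mO GO (measurable_normc_sqr_EFin mf)).
    - move=> x Gx; rewrite lee_fin /f !indicE mem_set// memNset ?subr0 ?normc1 ?expr1n//.
      by move=> /= Gxt; apply: (GnG _ Gxt); rewrite subrK.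
  apply: (ge0_subset_integral _ mG mO (measurable_normc_sqr_EFin mf)) => //.
  by move=> x _; rewrite lee_fin sqr_ge0.
apply/eqP; rewrite eq_le measure_ge0 andbT; apply: le_trans lG _.
by rewrite -(@pmule_rle0 _ a%:E) ?lte_fin.
Qed.

(** Split the overlap by [half_periods] into two sets, each disjoint from its
translate. *)
Lemma overlap_null (t : V) : dual_set Lambda t -> t != 0 ->
  m_d (Omega `&` (fun x => x + t) @^-1` Omega) = 0%E.
Proof.
move=> tL t0.
have [i ti] : exists i, t i ord0 != 0.
  apply/existsP; apply: contraNT t0 => /existsPn H.
  by apply/eqP/colP => i; have := H i; rewrite mxE negbK => /eqP.
have [Q [mQ' hQ]] := half_periods ti.
have mQ : measurable (Q : set LT) := measurable_lebesgueT mQ'.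
set E := _ `&` _.
have mE : measurable (E : set LT).
  by apply: measurableI => //; exact: measurable_shift_lebesgueT.
have H (P : set V) : measurable (P : set LT) -> (forall x, P x -> ~ P (x + t)) ->
    m_d (E `&` P) = 0%E.
  move=> mP hP; apply: (null_of_disjoint_translate tL).
  - exact: measurableI.
  - by move=> x [[]].
  - by move=> _ [x [[]] _ Ox _ <-].
  - by move=> x [_ Px] [_]; exact: hP.
have mQc : measurable (~` Q : set LT) by exact: measurableC.
have e1 : m_d (E `&` Q) = 0%E by apply: (H _ mQ) => x Qx /hQ.
have e2 : m_d (E `&` ~` Q) = 0%E.
  by apply: (H _ mQc) => x nQx; apply; apply/hQ.
have m1 : measurable (E `&` Q : set LT) by exact: measurableI.
have m2 : measurable (E `&` ~` Q : set LT) by exact: measurableI.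
have -> : E = (E `&` Q) `|` (E `&` ~` Q) by rewrite -setIUr setUv setIT.
apply/(negligibleP _ (measurableU _ _ m1 m2)).
by apply: negligibleU; [exact/(negligibleP _ m1)|exact/(negligibleP _ m2)].
Qed.

End overlap.

(** * One step of the iteration *)

Section sigma_map.
Context {R : realType} {d : nat}.
Local Notation V := 'cV[R]_d.
Local Notation LT := (lebesgueT R d).
Local Notation m_d := (lebesgue_measureT R d).
Variable M : 'M[R]_d.
Hypothesis uM : M \in unitmx.
Local Notation J := `|\det M|.

Lemma sigma_map_affine b :
  sigma_map M b = (fun x : V => invmx M *m x + invmx M *m b).
Proof. by apply/funext => x; rewrite /sigma_map mulmxDr. Qed.

Lemma measurable_sigma_map b : measurable_fun [set: V] (sigma_map M b : V -> V).
Proof. by rewrite sigma_map_affine; exact: measurable_affine_cV. Qed.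

(** Images become preimages under the inverse affine map, for which
measurability and scaling are known. *)
Lemma sigma_image b (S : set V) :
  sigma_map M b @` S = (fun y : V => M *m y + - b) @^-1` S.
Proof.
apply/seteqP; split => [_ [x Sx <-]|y Sy] /=.
  by rewrite /sigma_map mulKVmx// addrK.
by exists (M *m y + - b) => //; rewrite /sigma_map subrK mulKmx.
Qed.

Lemma sigma_preimage_image b (S : set V) :
  sigma_map M b @^-1` (sigma_map M b @` S) = S.
Proof.
rewrite sigma_image; apply/seteqP; split => x /=;
  by rewrite /sigma_map mulKVmx// addrK.
Qed.

Lemma unitmx_det_norm_gt0 : 0 < J.
Proof. by rewrite normr_gt0 -unitfE -unitmxE. Qed.

Lemma det_invmx_norm : `|\det (invmx M)|^-1 = J.
Proof. by rewrite det_inv normfV invrK. Qed.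

Lemma measurable_sigma_image b (S : set V) : measurable (S : set LT) ->
  measurable (sigma_map M b @` S : set LT).
Proof.
by move=> mS; rewrite sigma_image; exact: (measurable_preimage_affine (- b) uM mS).
Qed.

Let uN : invmx M \in unitmx. Proof. by rewrite unitmx_inv. Qed.

Lemma lebesgueT_sigma_preimage b (S : set V) :
  (m_d (sigma_map M b @^-1` S) = J%:E * m_d S)%E.
Proof.
have := lebesgueT_affine_preimage (invmx M *m b) S uN.
by rewrite -sigma_map_affine det_invmx_norm.
Qed.

Lemma ge0_integral_sigma b (S : set V) (h : V -> \bar R) :
  measurable (S : set LT) -> measurable_fun (sigma_map M b @` S : set LT) h ->
  (forall x, 0 <= h x)%E ->
  (\int[m_d]_(x in sigma_map M b @` S) h x =
   J^-1%:E * \int[m_d]_(x in S) h (sigma_map M b x))%E.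
Proof.
move=> mS mh h0.
have := @ge0_integral_affine R d _ (invmx M *m b) _ h uN
  (measurable_sigma_image b mS) mh (fun x _ => h0 x).
rewrite -sigma_map_affine sigma_preimage_image det_invmx_norm => E.
have -> : (\int[m_d]_(x in S) h (sigma_map M b x) =
    \int[m_d]_(x in S) h (invmx M *m x + invmx M *m b)%R)%E.
  by apply: eq_integral => x _; rewrite sigma_map_affine.
by rewrite E muleA -EFinM mulVf ?mul1e// gt_eqF// unitmx_det_norm_gt0.
Qed.

Lemma Cmeasurable_fun_sigma b (S : set V) (f : V -> R[i]) :
  measurable (S : set LT) ->
  Cmeasurable_fun (sigma_map M b @` S : set LT) f ->
  Cmeasurable_fun (S : set LT) (f \o sigma_map M b).
Proof.
move=> mS mf.
have := Cmeasurable_fun_affine (invmx M *m b) uN (measurable_sigma_image b mS) mf.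
by rewrite -sigma_map_affine sigma_preimage_image.
Qed.

Variable B : {fset V}.

Lemma Omega_iter1 (S : set V) :
  Omega_iter M B S 1 = \big[setU/set0]_(b <- B) (sigma_map M b @` S).
Proof. by rewrite /= -bigcup_seq. Qed.

Variable Omega : set V.
Hypothesis mO : measurable (Omega : set LT).
Local Notation Omega' := (Omega_iter M B Omega 1).

Lemma measurable_Omega_iter1 : measurable (Omega' : set LT).
Proof.
rewrite Omega_iter1; apply: bigsetU_measurable => b _.
exact: measurable_sigma_image.
Qed.

Lemma sub_Omega_iter1 b : b \in B -> sigma_map M b @` Omega `<=` Omega'.
Proof. by move=> bB; apply: (bigcup_sup (i := b)). Qed.

Hypothesis overlap : forall b b', b \in B -> b' \in B -> b != b' ->
  m_d (sigma_map M b @` Omega `&` sigma_map M b' @` Omega) = 0%E.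

Lemma ge0_integral_Omega_iter1 (h : V -> \bar R) :
  measurable_fun (Omega' : set LT) h -> (forall x, 0 <= h x)%E ->
  (\int[m_d]_(x in Omega') h x =
   J^-1%:E * \sum_(b <- B) \int[m_d]_(x in Omega) h (sigma_map M b x))%E.
Proof.
move=> mh h0.
have mh' b : b \in B -> measurable_fun (sigma_map M b @` Omega : set LT) h.
  by move=> bB; exact: (measurable_funS measurable_Omega_iter1 (sub_Omega_iter1 bB) mh).
rewrite Omega_iter1 in mh *.
rewrite (ge0_integral_bigsetU_ae (m := m_d) (fset_uniq B)
  (fun b => measurable_sigma_image b mO) overlap mh h0).
rewrite ge0_sume_distrr; last by move=> b _; exact: integral_ge0.
rewrite big_seq [RHS]big_seq; apply: eq_bigr => b bB.
exact: (ge0_integral_sigma mO (mh' b bB) h0).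
Qed.

Lemma Rintegral_Omega_iter1 (h : V -> R) : m_d.-integrable Omega' (EFin \o h) ->
  (forall b, b \in B -> m_d.-integrable Omega (EFin \o (h \o sigma_map M b))) ->
  Rintegral m_d Omega' h =
  J^-1 * \sum_(b <- B) Rintegral m_d Omega (h \o sigma_map M b).
Proof.
move=> ih ihb; have mh := measurable_int _ ih.
rewrite /Rintegral [in LHS]integralE.
have ep := ge0_integral_Omega_iter1 (measurable_funepos mh) (funepos_ge0 _).
have en := ge0_integral_Omega_iter1 (measurable_funeneg mh) (funeneg_ge0 _).
have ipos b : b \in B ->
    (\int[m_d]_(x in Omega) (EFin \o h)^\+ (sigma_map M b x) =
     (fine (\int[m_d]_(x in Omega) (EFin \o (h \o sigma_map M b))^\+ x))%:E)%E.
  move=> bB; rewrite fineK; last exact: (integrable_pos_fin_num mO (ihb b bB)).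
  by apply: eq_integral => x _; rewrite !funeposE.
have ineg b : b \in B ->
    (\int[m_d]_(x in Omega) (EFin \o h)^\- (sigma_map M b x) =
     (fine (\int[m_d]_(x in Omega) (EFin \o (h \o sigma_map M b))^\- x))%:E)%E.
  move=> bB; rewrite fineK; last exact: (integrable_neg_fin_num mO (ihb b bB)).
  by apply: eq_integral => x _; rewrite !funenegE.
rewrite ep en.
rewrite big_seq (eq_bigr _ ipos) -big_seq [X in (_ - _ * X)%E]big_seq
  (eq_bigr _ ineg) -big_seq !sumEFin -!EFinM -EFinB /= -mulrBr; congr (_ * _).
rewrite -sumrB big_seq [RHS]big_seq; apply: eq_bigr => b bB.
have E1 : (\int[m_d]_(x in Omega) ((h \o sigma_map M b) x)%:E =
    \int[m_d]_(x in Omega) (EFin \o (h \o sigma_map M b))^\+ x -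
    \int[m_d]_(x in Omega) (EFin \o (h \o sigma_map M b))^\- x)%E.
  exact: integralE.
rewrite E1; apply/esym/fineB.
  exact: (integrable_pos_fin_num mO (ihb b bB)).
exact: (integrable_neg_fin_num mO (ihb b bB)).
Qed.

Lemma Cintegral_Omega_iter1 (f : V -> R[i]) : Cintegrable m_d Omega' f ->
  (forall b, b \in B -> Cintegrable m_d Omega (f \o sigma_map M b)) ->
  Cintegral m_d Omega' f =
  J^-1%:C * \sum_(b <- B) Cintegral m_d Omega (f \o sigma_map M b).
Proof.
move=> [f1 f2] fb; rewrite /Cintegral.
rewrite (Rintegral_Omega_iter1 f1); last by move=> b /fb[].
rewrite (Rintegral_Omega_iter1 f2); last by move=> b /fb[].
by rewrite realcM Re_sum Im_sum.
Qed.

End sigma_map.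

(** The pairs of a branch and a point are in bijection with their images. *)
Lemma esum_tau_images (R : realType) (T T' : choiceType) (L : {fset T})
    (S : set T') (tau : T -> T' -> T') (N : T' -> \bar R) :
  (forall l l' s s', l \in L -> l' \in L -> S s -> S s' ->
     tau l s = tau l' s' -> l = l' /\ s = s') ->
  (forall x, 0 <= N x)%E ->
  (\esum_(x in \bigcup_(l in [set` L]) (tau l @` S)) N x =
   \sum_(l <- L) \esum_(s in S) N (tau l s))%E.
Proof.
move=> inj N0.
rewrite (fsbig_seq _ _ (fset_uniq L)) -esum_fset//; last first.
  by move=> l _; exact: esum_ge0.
rewrite esum_esum//; apply: (reindex_esum _ _ (fun k : T * T' => tau k.1 k.2)).
split.
- by move=> [l s] /= [lL Ss]; exists l => //; exists s.
- move=> [l s] [l' s']; rewrite !inE /= => -[lL Ss] [l'L Ss'] /inj.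
  by move=> /(_ lL l'L Ss Ss')[-> ->].
- by move=> x [l /= lL [s Ss <-]]; exists (l, s).
Qed.

(** Expanding the squares, the sum over [l] of the cross term of [b] and [b'] is
the sum of the exponential of [b' - b], which vanishes off the diagonal. *)
Lemma sum_sqnorm_exp_matrix (R : realType) d (B L : {fset 'cV[R]_d})
    (z : 'cV[R]_d -> R[i]) :
  (forall b b', b \in B -> b' \in B -> b != b' ->
     \sum_(l <- L) expi (b - b') l = 0) ->
  \sum_(l <- L) normc (\sum_(b <- B) (expi l b)^*%C * z b) ^+ 2 =
  #|` L|%:R * \sum_(b <- B) normc (z b) ^+ 2.
Proof.
move=> orth; apply: (@complexI R).
rewrite rmorphM rmorph_nat !rmorph_sum.
transitivity (\sum_(l <- L) \sum_(b <- B) \sum_(b' <- B)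
    (z b * (z b')^*%C) * expi (b' - b) l).
  apply: eq_bigr => l _; apply: etrans (normc_sqr_conj _) _.
  rewrite conjc_sum mulr_suml.
  apply: eq_bigr => b _; rewrite mulr_sumr; apply: eq_bigr => b' _.
  rewrite conjcM conjcK expiDl expiN ![expi _ l]expiC; ring.
rewrite exchange_big mulr_sumr big_seq [RHS]big_seq; apply: eq_bigr => b bB.
rewrite exchange_big (big_fsetD1 b)//= -mulr_sumr subrr.
rewrite [X in _ + X]big_seq [X in _ + X]big1 ?addr0; last first.
  move=> b'; rewrite !inE => /andP[bb' b'B].
  by rewrite -mulr_sumr orth// mulr0.
rewrite (eq_bigr (fun=> 1)) => [|l _]; last first.
  by rewrite expi_int// dotvE big1// => i _; rewrite mxE mul0r.
by rewrite big_const_seq count_predT iter_addr_0 -normc_sqr_conj mulrC.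
Qed.

Section frame_step.
Context {R : realType} {d : nat}.
Local Notation V := 'cV[R]_d.
Local Notation LT := (lebesgueT R d).
Local Notation m_d := (lebesgue_measureT R d).
Variables (Omega Lambda : set V) (a A : R) (M : 'M[R]_d) (B L : {fset V}).
Hypothesis hpair : generalized_spectral_pair Omega Lambda a A.
Hypothesis uM : M \in unitmx.
Hypothesis hB : [set` B] `<=` dual_set Lambda.
Hypothesis hL : forall l l' s s', l \in L -> l' \in L -> Lambda s -> Lambda s' ->
  s + l = s' + l' -> l = l'.
Hypothesis horth : forall b b', b \in B -> b' \in B -> b != b' ->
  \sum_(l <- L) expi (b - b') l = 0.
Hypothesis B0 : (0 < #|` B|)%N.
Hypothesis L0 : (0 < #|` L|)%N.
Local Notation J := `|\det M|.
Local Notation Omega' := (Omega_iter M B Omega 1).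
Local Notation Lambda' := (Lambda_iter M L Lambda 1).

Let J0 : 0 < J. Proof. exact: unitmx_det_norm_gt0. Qed.

Let mO : measurable (Omega : set LT). Proof. by case: hpair. Qed.

Let fO : (m_d Omega < +oo)%E. Proof. by case: hpair => _ /andP[]. Qed.

Let pO : (0 < m_d Omega)%E. Proof. by case: hpair => _ /andP[]. Qed.

Let mO' : measurable (Omega' : set LT).
Proof. exact: measurable_Omega_iter1. Qed.

(** Pulled back by [sigma_b], the intersection becomes the overlap of [Omega]
with its translate by [b - b'], a vector of the dual of [Lambda]. *)
Lemma sigma_overlap_null b b' : b \in B -> b' \in B -> b != b' ->
  m_d (sigma_map M b @` Omega `&` sigma_map M b' @` Omega) = 0%E.
Proof.
move=> bB b'B bb'.
have e := lebesgueT_sigma_preimage uM b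
  (sigma_map M b @` Omega `&` sigma_map M b' @` Omega).
have e0 : m_d (sigma_map M b @^-1`
    (sigma_map M b @` Omega `&` sigma_map M b' @` Omega)) = 0%E.
  rewrite preimage_setI sigma_preimage_image//.
  rewrite (_ : sigma_map M b @^-1` _ = (fun x : V => x + (b - b')) @^-1` Omega).
    apply: (overlap_null hpair); last by rewrite subr_eq0.
    move=> s Ls; rewrite dotvDl dotvN rpredB//; [exact: hB bB _ Ls|exact: hB b'B _ Ls].
  rewrite sigma_image//; apply/seteqP; split => x /=;
    by rewrite /sigma_map mulKVmx// addrA.
move: e; rewrite e0 => /esym/eqP; rewrite mule_eq0 => /orP[|/eqP//].
by rewrite eqe gt_eqF.
Qed.

Lemma lebesgueT_Omega_iter1 :
  (m_d Omega' = (#|` B|%:R / J)%:E * m_d Omega)%E.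
Proof.
have := ge0_integral_Omega_iter1 uM mO sigma_overlap_null
  (h := cst 1%E) (measurable_cst _) (fun=> lee01).
rewrite integral_cst// mul1e => ->.
under eq_bigr do rewrite integral_cst// mul1e.
have fE : m_d Omega = (fine (m_d Omega))%:E by rewrite fineK// ge0_fin_numE.
rewrite fE sumEFin big_const_seq count_predT iter_addr_0 -!EFinM -mulr_natl.
by congr EFin; field; rewrite gt_eqF.
Qed.

Section transfer.
Variable f : V -> R[i].
Hypothesis L2f : L2 m_d Omega' f.

Let mf : Cmeasurable_fun (Omega' : set LT) f. Proof. by case: L2f. Qed.

Let mfb b : b \in B -> Cmeasurable_fun (Omega : set LT) (f \o sigma_map M b).
Proof.
move=> bB; apply: (Cmeasurable_fun_sigma uM mO).
have [f1 f2] := mf.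
by split; [exact: (measurable_funS mO' (sub_Omega_iter1 bB) f1)|
           exact: (measurable_funS mO' (sub_Omega_iter1 bB) f2)].
Qed.

Lemma sum_sqnorm2_sigma :
  (\sum_(b <- B) sqnorm2 m_d Omega (f \o sigma_map M b) =
   J%:E * sqnorm2 m_d Omega' f)%E.
Proof.
rewrite {2}/sqnorm2 (ge0_integral_Omega_iter1 uM mO sigma_overlap_null
  (measurable_normc_sqr_EFin mf)); last by move=> x; rewrite lee_fin sqr_ge0.
by rewrite muleA -EFinM mulfV ?mul1e// gt_eqF.
Qed.

Let fin_sqnorm : (J%:E * sqnorm2 m_d Omega' f < +oo)%E.
Proof. by case: L2f => _ _ ff; rewrite lte_mul_pinfty// lee_fin ltW. Qed.

Let L2fb b : b \in B -> L2 m_d Omega (f \o sigma_map M b).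
Proof.
move=> bB; have [f1 f2] := mfb bB; split => //.
apply: le_lt_trans fin_sqnorm; rewrite -sum_sqnorm2_sigma (big_fsetD1 b)//=.
by rewrite leeDl// sume_ge0// => b' _; exact: sqnorm2_ge0.
Qed.

(** The function on [Omega] whose coefficients on [Lambda] are those of [f] on
[tau_map M l @` Lambda].  The Jacobian is put into the function so that no
scaling of infinite sums is needed. *)
Definition transfer (l y : V) : R[i] :=
  J^-1%:C * ((expi l y)^*%C * \sum_(b <- B) (expi l b)^*%C * f (sigma_map M b y)).

Let g0 (l y : V) := \sum_(b <- B) (expi l b)^*%C * f (sigma_map M b y).

Let mu (l : V) : Cmeasurable_fun (Omega : set LT) (fun y => (expi l y)^*%C).
Proof. exact/Cmeasurable_conjc/Cmeasurable_lebesgueT/Cmeasurable_expi. Qed.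

Let mg0 l : Cmeasurable_fun (Omega : set LT) (g0 l).
Proof.
apply: Cmeasurable_fun_sum => b bB; apply: Cmeasurable_funM; last exact: mfb.
exact: Cmeasurable_cst.
Qed.

Let u1 (l y : V) : normc (expi l y)^*%C = 1.
Proof. by rewrite normc_conj normc_expi. Qed.

Let sum_g0 : (\sum_(l <- L) sqnorm2 m_d Omega (g0 l) =
  (#|` L|%:R * J)%:E * sqnorm2 m_d Omega' f)%E.
Proof.
rewrite -(sqnorm2_sum m_d mO (fun l _ => mg0 l)).
under eq_integral do rewrite (sum_sqnorm_exp_matrix _ horth) EFinM.
have mS : measurable_fun (Omega : set LT)
    (fun y => (\sum_(b <- B) normc (f (sigma_map M b y)) ^+ 2)%:E).
  apply/measurable_EFinP; under eq_fun do rewrite big_seq_fsetE.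
  by apply: measurable_sum => b; exact: measurable_normc_sqr (mfb (valP b)).
rewrite (ge0_integralZl_EFin m_d mO _ mS)//; last first.
  by move=> y _; rewrite lee_fin sumr_ge0// => b _; exact: sqr_ge0.
have E : (\int[m_d]_(y in Omega) (\sum_(b <- B) normc (f (sigma_map M b y)) ^+ 2)%:E
    = \sum_(b <- B) sqnorm2 m_d Omega (f \o sigma_map M b))%E.
  exact: (sqnorm2_sum m_d mO mfb).
by rewrite E sum_sqnorm2_sigma EFinM muleA.
Qed.

Let L2g0 l : l \in L -> L2 m_d Omega (g0 l).
Proof.
move=> lL; have [f1 f2] := mg0 l; split => //.
apply: (@le_lt_trans _ _ (\sum_(l <- L) sqnorm2 m_d Omega (g0 l))%E).
  rewrite (big_fsetD1 l)//= leeDl// sume_ge0// => b' _; exact: sqnorm2_ge0.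
by rewrite sum_g0 EFinM -muleA lte_mul_pinfty.
Qed.

Lemma L2_transfer l : l \in L -> L2 m_d Omega (transfer l).
Proof.
move=> lL.
exact: (L2Z J^-1 mO (L2_unimodularM (mu l) (u1 l) (L2g0 lL))).
Qed.

Lemma sum_sqnorm2_transfer :
  (\sum_(l <- L) sqnorm2 m_d Omega (transfer l) =
   (#|` L|%:R / J)%:E * sqnorm2 m_d Omega' f)%E.
Proof.
have E l : (sqnorm2 m_d Omega (transfer l) =
    (J^-1 ^+ 2)%:E * sqnorm2 m_d Omega (g0 l))%E.
  have -> := sqnorm2Z m_d J^-1 mO (Cmeasurable_funM (mu l) (mg0 l)).
  congr (_ * _)%E; apply: eq_integral => y _.
  by rewrite normcM u1 mul1r.
under eq_bigr do rewrite E.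
rewrite -ge0_sume_distrr; last by move=> l _; exact: sqnorm2_ge0.
rewrite sum_g0 muleA -EFinM; congr (_%:E * _)%E.
by field; rewrite gt_eqF.
Qed.

(** In the exponential at [tau_l s] and [sigma_b y] the linear parts cancel and
leave [e_(s+l) (y + b)], whose factor [e_s b] is [1]. *)
Lemma Fourier_transfer l s : l \in L -> Lambda s ->
  Cintegral m_d Omega' (fun x => (expi (tau_map M l s) x)^*%C * f x) =
  Cintegral m_d Omega (fun y => (expi s y)^*%C * transfer l y).
Proof.
move=> lL Ls.
have mu' : Cmeasurable_fun (Omega' : set LT) (fun y => (expi (tau_map M l s) y)^*%C).
  exact/Cmeasurable_conjc/Cmeasurable_lebesgueT/Cmeasurable_expi.
have fO' : (m_d Omega' < +oo)%E.
  by rewrite lebesgueT_Omega_iter1 lte_mul_pinfty// lee_fin divr_ge0// ltW.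
have L2uf : L2 m_d Omega' (fun x => (expi (tau_map M l s) x)^*%C * f x).
  by apply: L2_unimodularM mu' _ L2f => x; rewrite normc_conj normc_expi.
pose F b y := (expi s y)^*%C * ((expi l y)^*%C * ((expi l b)^*%C * f (sigma_map M b y))).
have L2F b : b \in B -> L2 m_d Omega (F b).
  move=> bB.
  have c1 : Cmeasurable_fun (Omega : set LT) (fun=> (expi l b)^*%C).
    exact: Cmeasurable_cst.
  exact: (L2_unimodularM (mu s) (u1 s) (L2_unimodularM (mu l) (u1 l)
    (L2_unimodularM c1 (fun=> u1 l b) (L2fb bB)))).
have iF b : b \in B -> Cintegrable m_d Omega (F b).
  by move=> bB; exact: L2_Cintegrable mO fO (L2F b bB).
have FE b : b \in B ->
    (fun x => (expi (tau_map M l s) x)^*%C * f x) \o sigma_map M b = F b.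
  move=> bB; apply/funext => y.
  change ((expi (tau_map M l s) (sigma_map M b y))^*%C * f (sigma_map M b y) = F b y).
  rewrite /F.
  have -> : expi (tau_map M l s) (sigma_map M b y) = expi s y * expi l y * expi l b.
    have -> : expi (tau_map M l s) (sigma_map M b y) = expi (s + l) (y + b).
      by rewrite /expi /tau_map dotv_mulmx /sigma_map mulKVmx.
    rewrite expiDl !expiDr (expi_int (x := s) (y := b)); last first.
      by rewrite dotvC; exact: hB.
    by rewrite mulr1 mulrA.
  by rewrite !conjcM !mulrA.
rewrite (Cintegral_Omega_iter1 uM mO sigma_overlap_null); last 2 first.
- exact: L2_Cintegrable mO' fO' L2uf.
- by move=> b bB; rewrite FE//; exact: iF.
rewrite big_seq (eq_bigr (fun b => Cintegral m_d Omega (F b))); last first.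
  by move=> b bB; rewrite FE.
have FsumE : (fun y => \sum_(b <- B) F b y) =
    (fun y => (expi s y)^*%C * ((expi l y)^*%C * g0 l y)).
  by apply/funext => y; rewrite /F /g0 !mulr_sumr.
rewrite -big_seq -(Cintegral_sum mO iF) FsumE.
have iG := L2_Cintegrable mO fO
  (L2_unimodularM (mu s) (u1 s) (L2_unimodularM (mu l) (u1 l) (L2g0 lL))).
rewrite -(CintegralZ _ mO iG); congr Cintegral.
by apply/funext => y; rewrite /transfer /g0; ring.
Qed.

End transfer.

(** Sum over [l] the frame inequalities of [(Omega, Lambda)] for the functions
[transfer f l]. *)
Theorem generalized_spectral_pair_step :
  generalized_spectral_pair Omega' Lambda' (a * (#|` L|%:R / J)) (A * (#|` L|%:R / J)).
Proof.
have c0 : 0 < #|` L|%:R / J by rewrite divr_gt0// ltr0n.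
have b0 : 0 < #|` B|%:R / J by rewrite divr_gt0// ltr0n.
have [_ _ /andP[a0 aA] hfr] := hpair.
split.
- exact: mO'.
- by rewrite lebesgueT_Omega_iter1 mule_gt0//= lte_mul_pinfty// lee_fin ltW.
- by rewrite mulr_gt0//= ler_pM2r.
- move=> f L2f /=.
  have tauinj l l' s s' : l \in L -> l' \in L -> Lambda s -> Lambda s' ->
      tau_map M l s = tau_map M l' s' -> l = l' /\ s = s'.
    move=> lL l'L Ls Ls' /(congr1 (mulmx (invmx M^T))).
    rewrite /tau_map !mulKmx ?unitmx_tr// => E.
    have ll := hL lL l'L Ls Ls' E; split => //.
    by move: E; rewrite ll => /addIr.
  rewrite (esum_tau_images tauinj); last by move=> x; rewrite lee_fin sqr_ge0.
  have E l : l \in L ->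
    (\esum_(s in Lambda) (normc (Cintegral m_d Omega'
        (fun x => (expi (tau_map M l s) x)^*%C * f x)) ^+ 2)%:E =
     \esum_(s in Lambda) (normc (Cintegral m_d Omega
        (fun y => (expi s y)^*%C * transfer f l y)) ^+ 2)%:E)%E.
    by move=> lL; apply: eq_esum => s Ls; rewrite Fourier_transfer.
  rewrite big_seq (eq_bigr _ E) -big_seq ![(_ * (_ / _))%:E]EFinM -!muleA.
  rewrite -(sum_sqnorm2_transfer L2f) !ge0_sume_distrr;
    try by move=> l _; exact: sqnorm2_ge0.
  rewrite !big_seq; split; apply: lee_sum => l lL;
    by have [] := hfr _ (L2_transfer L2f lL).
Qed.

End frame_step.

(** * All levels of the iteration *)

Section iterates.
Context {R : realType} {d : nat}.
Local Notation V := 'cV[R]_d.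
Local Notation LT := (lebesgueT R d).
Local Notation m_d := (lebesgue_measureT R d).
Variables (Omega Lambda : set V) (a A : R) (M : 'M[R]_d) (B L : {fset V}).
Hypothesis hpair : generalized_spectral_pair Omega Lambda a A.
Hypothesis uM : M \in unitmx.
Hypothesis hii : mulmx M @` dual_set Lambda `<=` dual_set Lambda.
Hypothesis hiii : [set` B] `<=` dual_set Lambda.
Hypothesis hiv : [set` L] `<=` mulmx (invmx M^T) @` dual_set (dual_set Lambda).
Hypothesis hv : forall l l' : V, l \in L -> l' \in L -> l != l' ->
  [set l + t | t in dual_set (dual_set Lambda)] `&`
  [set l' + t | t in dual_set (dual_set Lambda)] = set0.
Hypothesis horth : forall b b' : V, b \in B -> b' \in B -> b != b' ->
  \sum_(l <- L) expi (b - b') l = 0.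
Hypothesis B0 : (0 < #|` B|)%N.
Hypothesis L0 : (0 < #|` L|)%N.
Local Notation J := `|\det M|.
Local Notation Omega_ n := (Omega_iter M B Omega n).
Local Notation Lambda_ n := (Lambda_iter M L Lambda n).

(** Stability of the dual of [Lambda] under [M] is stability of the double dual
under [M^T], and the hypothesis on [L] puts the vectors [M^T l] in the double
dual. *)
Lemma Lambda_iter_bidual n : Lambda_ n `<=` dual_set (dual_set Lambda).
Proof.
elim: n => [s Ls t|n ih _ [l lL [s /ih Ls <-]] t] /=.
  by rewrite dotvC; exact.
move=> tL; rewrite /tau_map mulmxDr dotvDl rpredD//.
  by rewrite dotv_mulmx; apply: Ls; apply: hii; exists t.
have [u uL <-] := hiv lL.
by rewrite mulKVmx ?unitmx_tr//; exact: uL.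
Qed.

Lemma generalized_spectral_pair_iter n :
  generalized_spectral_pair (Omega_ n) (Lambda_ n)
    (a * (#|` L|%:R / J) ^+ n) (A * (#|` L|%:R / J) ^+ n).
Proof.
elim: n => [|n ih]; first by rewrite !expr0 !mulr1.
have E (x c : R) : x * c ^+ n.+1 = x * c ^+ n * c by rewrite exprSr mulrA.
rewrite !{}E.
have hBn : [set` B] `<=` dual_set (Lambda_ n).
  by move=> b bB s /Lambda_iter_bidual Ls; rewrite dotvC; apply: Ls; exact: hiii.
have hLn l l' s s' : l \in L -> l' \in L -> Lambda_ n s -> Lambda_ n s' ->
    s + l = s' + l' -> l = l'.
  move=> lL l'L /Lambda_iter_bidual Ls /Lambda_iter_bidual Ls' E.
  apply/eqP; apply: contraT => ll'.
  have := hv lL l'L ll'; move/seteqP => [/(_ (s + l)) H _].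
  case: H; split; first by exists s => //; rewrite addrC.
  by exists s' => //; rewrite E addrC.
exact: (generalized_spectral_pair_step ih uM hBn hLn horth B0 L0).
Qed.

Lemma measurable_Omega_iter n : measurable (Omega_ n : set LT).
Proof. by case: (generalized_spectral_pair_iter n). Qed.

Lemma sigma_overlap_iter_null n b b' : b \in B -> b' \in B -> b != b' ->
  m_d (sigma_map M b @` Omega_ n `&` sigma_map M b' @` Omega_ n) = 0%E.
Proof.
apply: (sigma_overlap_null (generalized_spectral_pair_iter n) uM).
by move=> c cB s /Lambda_iter_bidual Ls; rewrite dotvC; apply: Ls; exact: hiii.
Qed.

Lemma lebesgueT_Omega_iter n :
  (m_d (Omega_ n) = ((#|` B|%:R / J) ^+ n)%:E * m_d Omega)%E.
Proof.
elim: n => [|n ih]; first by rewrite expr0 mul1e.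
have hBn : [set` B] `<=` dual_set (Lambda_ n).
  by move=> c cB s /Lambda_iter_bidual Ls; rewrite dotvC; apply: Ls; exact: hiii.
have := lebesgueT_Omega_iter1 (generalized_spectral_pair_iter n) uM hBn.
by move=> E; rewrite [LHS]E ih muleA -EFinM -exprS.
Qed.

Lemma ge0_integral_Omega_iterS n (h : V -> \bar R) :
  measurable_fun (setT : set LT) h -> (forall x, 0 <= h x)%E ->
  (\int[m_d]_(x in Omega_ n.+1) h x =
   J^-1%:E * \sum_(b <- B) \int[m_d]_(x in Omega_ n) h (sigma_map M b x))%E.
Proof.
move=> mh h0.
apply: (ge0_integral_Omega_iter1 uM (measurable_Omega_iter n)
  (@sigma_overlap_iter_null n) _ h0).
exact: measurable_funTS mh.
Qed.

Local Notation level n := (level_measure M B Omega n).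
Local Notation vol := (fine (m_d Omega)).
Local Notation c_ n := (J ^+ n / (#|` B|%:R ^+ n * vol)).

Let J0 : 0 < J. Proof. exact: unitmx_det_norm_gt0. Qed.

Let vol0 : 0 < vol.
Proof. by case: hpair => _ /andP[m0 moo] _ _; rewrite fine_gt0// m0. Qed.

Let volE : m_d Omega = vol%:E.
Proof.
by case: hpair => _ /andP[m0 moo] _ _; rewrite fineK// ge0_fin_numE// ltW.
Qed.

Lemma level_weight_gt0 n : 0 < c_ n.
Proof. by rewrite divr_gt0 ?mulr_gt0 ?exprn_gt0// ltr0n. Qed.

(** The level measure is defined on Borel sets while [Omega_n] is only Lebesgue
measurable, so both sides are compared through the restriction of the completed
measure to [Omega_n]. *)
Lemma ge0_integral_level n (h : V -> \bar R) :
  measurable_fun [set: V] h -> (forall x, 0 <= h x)%E ->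
  (\int[level n]_x h x = (c_ n)%:E * \int[m_d]_(x in Omega_ n) h x)%E.
Proof.
move=> mh h0.
have mOn := measurable_Omega_iter n.
have mOnc : measurable (~` Omega_ n : set LT) by exact: measurableC.
have mh' : measurable_fun (setT : set LT) h.
  exact: (measurableT_comp mh measurable_id_lebesgueT).
pose r := mrestr m_d mOn.
have c0 : 0 <= (c_ n)^-1 by rewrite invr_ge0 ltW// level_weight_gt0.
have E1 : (\int[r]_x h x = (c_ n)^-1%:E * \int[level n]_x h x)%E.
  have rE (E : set V) : measurable E -> E `<=` setT ->
      r (id @^-1` E) = ((c_ n)^-1%:E * level n E)%E.
    move=> mE _; rewrite /level_measure muleA -EFinM.
    by rewrite mulVf ?mul1e// gt_eqF// level_weight_gt0.
  exact: (@ge0_integral_comp_scale _ _ LT V R r (level n) id (c_ n)^-1 setT h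
    measurable_id_lebesgueT c0 measurableT rE mh (fun x _ => h0 x)).
have E2 : (\int[r]_x h x = \int[m_d]_(x in Omega_ n) h x)%E.
  rewrite -(setUv (Omega_ n)).
  rewrite (ge0_integral_setU r mOn mOnc); last 3 first.
  - by rewrite setUv; exact: mh'.
  - by move=> x _; exact: h0.
  - by apply/disj_setPS => x [].
  have -> : (\int[r]_(x in ~` Omega_ n) h x = 0)%E.
    apply: (null_set_integral (mOnc : measurable _)).
      exact: measurable_funTS mh'.
    change (m_d (~` Omega_ n `&` Omega_ n) = 0%E).
    by rewrite setIC setICr measure0.
  rewrite adde0; apply: eq_measure_integral => E mE EO.
  change (m_d (E `&` Omega_ n) = m_d E).
  by rewrite (setIidl EO).
have cn0 : c_ n != 0 by rewrite gt_eqF// level_weight_gt0.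
by rewrite -E2 E1 muleA -EFinM mulfV// mul1e.
Qed.

Lemma Rintegral_level n (h : V -> R) : measurable_fun [set: V] h ->
  m_d.-integrable (Omega_ n) (EFin \o h) ->
  Rintegral (level n) setT h = c_ n * Rintegral m_d (Omega_ n) h.
Proof.
move=> mh ih; have mOn := measurable_Omega_iter n.
have mh' : measurable_fun [set: V] (EFin \o h) by exact/measurable_EFinP.
have ep := ge0_integral_level n (measurable_funepos mh') (funepos_ge0 _).
have en := ge0_integral_level n (measurable_funeneg mh') (funeneg_ge0 _).
have pf := integrable_pos_fin_num mOn ih.
have nf := integrable_neg_fin_num mOn ih.
have E1 : (\int[level n]_x (h x)%:E = \int[level n]_x (EFin \o h)^\+ x -
    \int[level n]_x (EFin \o h)^\- x)%E by exact: integralE.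
have E2 : (\int[m_d]_(x in Omega_ n) (h x)%:E =
    \int[m_d]_(x in Omega_ n) (EFin \o h)^\+ x -
    \int[m_d]_(x in Omega_ n) (EFin \o h)^\- x)%E by exact: integralE.
rewrite /Rintegral E1 E2 ep en.
by rewrite -(fineK pf) -(fineK nf) -!EFinM -!EFinB /= mulrBr.
Qed.

Section level_frame.
Variables (n : nat) (f : V -> R[i]).
Hypothesis mf : Cmeasurable_fun [set: V] f.
Hypothesis L2f : L2 m_d (Omega_ n) f.

Let fOn : (m_d (Omega_ n) < +oo)%E.
Proof. by rewrite lebesgueT_Omega_iter volE ltry. Qed.

(** The normalizing constant is moved into the function, so that the frame
inequalities apply to it directly. *)
Lemma level_FourierE lam : level_Fourier M B Omega n f lam =
  Cintegral m_d (Omega_ n) (fun x => (expi lam x)^*%C * ((c_ n)%:C * f x)).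
Proof.
have mOn := measurable_Omega_iter n.
have me : Cmeasurable_fun [set: V] (fun x => (expi lam x)^*%C).
  exact/Cmeasurable_conjc/Cmeasurable_expi.
have u1 x : normc (expi lam x)^*%C = 1 by rewrite normc_conj normc_expi.
have [m1 m2] : Cmeasurable_fun [set: V] (fun x => (expi lam x)^*%C * f x).
  exact: Cmeasurable_funM.
have [i1 i2] := L2_Cintegrable mOn fOn
  (L2_unimodularM (Cmeasurable_lebesgueT (Omega_ n) me) u1 L2f).
transitivity ((c_ n)%:C *
    Cintegral m_d (Omega_ n) (fun x => (expi lam x)^*%C * f x)).
  rewrite /level_Fourier (_ : (fun x => _) = fun x => (expi lam x)^*%C * f x).
    by rewrite /Cintegral !Rintegral_level// realcM.
  by apply/funext => x; rewrite mulrC.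
rewrite -(CintegralZ _ mOn (conj i1 i2)); congr Cintegral.
by apply/funext => x; rewrite mulrCA.
Qed.

Lemma sqnorm2_level :
  (sqnorm2 (level n) setT f = (c_ n)%:E * sqnorm2 m_d (Omega_ n) f)%E.
Proof.
apply: (ge0_integral_level n (measurable_normc_sqr_EFin mf)).
by move=> x; rewrite lee_fin sqr_ge0.
Qed.

(** The factor [(|L| / |det M|)^n] in the frame constants, the normalization of
the level measure and the factor [(|B| / |L|)^n] cancel. *)
Theorem level_frame_bounds :
  let S := (((#|` B|%:R / #|` L|%:R) ^+ n)%:E *
     \esum_(lam in Lambda_ n)
       (normc (level_Fourier M B Omega n f lam) ^+ 2)%:E)%E in
  ((a / vol)%:E * sqnorm2 (level n) setT f <= S)%E /\
  (S <= (A / vol)%:E * sqnorm2 (level n) setT f)%E.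
Proof.
have mOn := measurable_Omega_iter n.
have [_ _ _ /(_ _ (L2Z (c_ n) mOn L2f))] := generalized_spectral_pair_iter n.
rewrite /= (eq_esum (b := fun lam =>
  (normc (level_Fourier M B Omega n f lam) ^+ 2)%:E)); last first.
  by move=> lam _; rewrite level_FourierE.
rewrite (sqnorm2Z m_d _ mOn (L2_Cmeasurable L2f)) sqnorm2_level.
set e := sqnorm2 _ _ _; set S := esum _ _ => -[lo up].
have k0 : 0 < (#|` B|%:R / #|` L|%:R) ^+ n :> R.
  by rewrite exprn_gt0// divr_gt0// ltr0n.
have E (x : R) : ((x / vol)%:E * ((c_ n)%:E * e) =
    ((#|` B|%:R / #|` L|%:R) ^+ n)%:E *
    ((x * (#|` L|%:R / J) ^+ n)%:E * ((c_ n ^+ 2)%:E * e)))%E.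
  rewrite !muleA -!EFinM; congr (_%:E * _)%E.
  have b0 : #|` B|%:R != 0 :> R by rewrite pnatr_eq0 -lt0n.
  have l0 : #|` L|%:R != 0 :> R by rewrite pnatr_eq0 -lt0n.
  rewrite !expr_div_n; field.
  by rewrite !expf_neq0//= ?gt_eqF.
by rewrite !E; split; rewrite lee_pmul2l// lte_fin.
Qed.

End level_frame.

End iterates.

(** * Averages over the branches and convergence of the level measures *)

Section averaging.
Context {R : realType} {d : nat}.
Local Notation V := 'cV[R]_d.
Variables (M : 'M[R]_d) (B : {fset V}).
Hypothesis B0 : (0 < #|` B|)%N.
Local Notation N := (mulmx (invmx M)).

Definition avg (g : V -> R) (x : V) : R :=
  #|` B|%:R^-1 * \sum_(b <- B) g (sigma_map M b x).

Let n0 : 0 < #|` B|%:R :> R. Proof. by rewrite ltr0n. Qed.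

Lemma avg_const (c : R) : #|` B|%:R^-1 * (\sum_(b <- B) c) = c.
Proof.
by rewrite big_const_seq count_predT iter_addr_0 -[c *+ _]mulr_natl mulKf// gt_eqF.
Qed.

Lemma avg_le g (C : R) x : (forall b, b \in B -> g (sigma_map M b x) <= C) ->
  avg g x <= C.
Proof.
move=> gC; rewrite -[leRHS]avg_const /avg ler_pM2l ?invr_gt0//.
by rewrite big_seq [leRHS]big_seq; apply: ler_sum.
Qed.

Lemma avg_ge0 g : (forall x, 0 <= g x) -> forall x, 0 <= avg g x.
Proof. by move=> g0 x; rewrite mulr_ge0 ?invr_ge0// sumr_ge0. Qed.

Lemma iter_avg_ge0 n g : (forall x, 0 <= g x) -> forall x, 0 <= iter n avg g x.
Proof. by move=> g0; elim: n => //= n ih; exact: avg_ge0. Qed.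

Lemma measurable_avg g : measurable_fun [set: V] g -> measurable_fun [set: V] (avg g).
Proof.
move=> mg; apply: measurable_funM => //; apply: measurable_sum => b.
by apply: measurableT_comp mg _; exact: measurable_sigma_map.
Qed.

Lemma measurable_iter_avg n g : measurable_fun [set: V] g ->
  measurable_fun [set: V] (iter n avg g).
Proof. by move=> mg; elim: n => //= n; exact: measurable_avg. Qed.

Lemma iter_avg_le n g (S : set V) (C : R) :
  (forall p, Omega_iter M B S n p -> g p <= C) ->
  forall x, S x -> iter n avg g x <= C.
Proof.
elim: n g => [//|n ih] g gC x Sx; rewrite iterSr; apply: ih Sx => p pn.
apply: avg_le => b bB; apply: gC => /=.
by exists b => //; exists p.
Qed.

(** Following the same branches from [x] and from [y], the two points stay at
difference [N^n (y - x)]. *)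
Lemma iter_avg_dist n g (e : R) x y :
  (forall p, Omega_iter M B [set x] n p ->
     `|g p - g (p + iter n N (y - x))| <= e) ->
  `|iter n avg g x - iter n avg g y| <= e.
Proof.
elim: n g => [|n ih] g ge.
  by have := ge x erefl; rewrite /= [x + _]addrC subrK.
rewrite !iterSr; apply: ih => p pn.
rewrite /avg -mulrBr normrM ger0_norm ?invr_ge0// -sumrB.
rewrite -[leRHS]avg_const ler_pM2l ?invr_gt0//.
apply: le_trans (ler_norm_sum _ _ _) _.
rewrite big_seq [leRHS]big_seq; apply: ler_sum => b bB.
have -> : sigma_map M b (p + iter n N (y - x)) =
    sigma_map M b p + iter n.+1 N (y - x).
  by rewrite /sigma_map/= -mulmxDr addrAC.
by apply: ge => /=; exists b => //; exists p.
Qed.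

Hypothesis hM : expansive M.

(** All the points reached from [x] lie in a common box, on which [g] is
uniformly continuous. *)
Lemma iter_avg_cvg0 (g : V -> R) (x : V) : continuous g ->
  iter n avg g x - iter n avg g 0 @[n --> \oo] --> 0.
Proof.
move=> cg; apply/cvgr0Pnorm_le => e e0.
have xr : box (\sum_i `|x i ord0|) x.
  by move=> i; rewrite (bigD1 i)//= lerDl sumr_ge0.
have [C hC] := Omega_iter_box B hM (\sum_i `|x i ord0|).
have [del del0 hdel] := uniform_continuous_box C cg e0.
have := orbit_cvg0 hM (0 - x) del0; apply: filterS => n bn.
apply: iter_avg_dist => p pn; apply: hdel bn.
apply: (hC n); apply: Omega_iter_subset pn.
by move=> _ ->.
Qed.

Lemma iter_avg_bounded_box (g : V -> R) (r : R) : continuous g ->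
  exists K, forall n x, box r x -> iter n avg g x <= K.
Proof.
move=> cg; have [C hC] := Omega_iter_box B hM r.
have [K hK] := continuous_bounded_box C cg.
exists K => n x xr; apply: (iter_avg_le (S := box r)) xr => p /hC; exact: hK.
Qed.

(** Dominated convergence, the iterates being compared with their values at the
origin.  The set [D] of full measure on which they are bounded is the whole
space when [g] is bounded, and a box when [nu] has bounded support. *)
Lemma integral_iter_avg_cvg (nu : {measure set V -> \bar R}) (D : set V)
    (g : V -> R) (K : R) :
  continuous g -> (forall x, 0 <= g x) ->
  measurable D -> nu D = 1%E -> nu (~` D) = 0%E ->
  (forall n x, D x -> iter n avg g x <= K) ->
  (forall n, (\int[nu]_x (iter n avg g x)%:E)%E =
     (Rintegral nu D (iter n avg g))%:E) /\
  Rintegral nu D (iter n avg g) - iter n avg g 0 @[n --> \oo] --> 0.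
Proof.
move=> cg g0 mD nu1 nu0 gK.
have mg := measurable_fun_continuous_cV cg.
have [K0 hK0] := iter_avg_bounded_box 0 cg.
have b0 : box 0 (0 : V) by move=> i; rewrite mxE normr0.
have mq n : measurable_fun D (iter n avg g).
  exact: measurable_funTS (measurable_iter_avg n mg).
have icst (c : R) : nu.-integrable D (fun=> c%:E).
  apply/integrableP; split; first exact: measurable_cst.
  by rewrite integral_cst//= nu1 mule1 ltry.
have iq n : nu.-integrable D (EFin \o iter n avg g).
  apply: (le_integrable mD _ _ (icst K)); first exact/measurable_EFinP.
  move=> x Dx /=; rewrite lee_fin ger0_norm; last exact: iter_avg_ge0.
  by rewrite (le_trans (gK n x Dx))// ler_norm.
split=> [n|].
  rewrite (ge0_negligible_integral (N := ~` D)) ?setTD ?setCK//.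
  - by rewrite /Rintegral fineK//; exact: (integrable_fin_num mD (iq n)).
  - exact: measurableC.
  - by apply/measurable_EFinP; exact: measurable_iter_avg.
  - by move=> x _; rewrite lee_fin; exact: iter_avg_ge0.
have dom n x : D x -> `|iter n avg g x - iter n avg g 0| <= K + K0.
  move=> Dx; rewrite ler_norml; have := gK n x Dx; have := hK0 n 0 b0.
  have := iter_avg_ge0 n g0 x; have := iter_avg_ge0 n g0 0; lra.
have [|||_ _] := @dominated_convergence _ _ R nu D mD
  (fun n x => (iter n avg g x - iter n avg g 0)%:E) (cst 0%E) (cst (K + K0)%:E)
  _ (measurable_cst _) _ (icst _) _.
- by move=> n; apply/measurable_EFinP; apply: measurable_funB.
- by apply/aeW => x Dx; apply: cvg_EFin; [exact: nearW|exact: iter_avg_cvg0].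
- by apply/aeW => x n Dx; rewrite lee_fin; exact: dom.
rewrite integral0 => H; apply: cvg_trans (fine_cvg H).
apply: near_eq_cvg; apply: nearW => n /=.
transitivity (Rintegral nu D (fun x => iter n avg g x - iter n avg g 0)) => //.
rewrite RintegralB//; last exact: icst.
by rewrite Rintegral_cst// nu1 mulr1.
Qed.

End averaging.

Section hutchinson.
Context {R : realType} {d : nat}.
Local Notation V := 'cV[R]_d.
Variables (M : 'M[R]_d) (B : {fset V}) (mu : probability V R).
Hypothesis hmu : hutchinson_measure M B mu.

Lemma hutchinson_card_gt0 : (0 < #|` B|)%N.
Proof.
rewrite lt0n; apply/eqP => B0.
have [_ /(_ setT measurableT)] := hmu.
rewrite probability_setT (cardfs0_eq B0) big_seq_fset0 mule0.
by move=> /eqP; rewrite onee_eq0.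
Qed.

Lemma ge0_integral_avg (m : {measure set V -> \bar R}) (g : V -> R) :
  measurable_fun [set: V] g -> (forall x, 0 <= g x) ->
  (\int[m]_x (avg M B g x)%:E = (#|` B|%:R^-1)%:E *
     \sum_(b <- B) \int[m]_x (g (sigma_map M b x))%:E)%E.
Proof.
move=> mg g0.
have mgb b : measurable_fun [set: V] (fun x => (g (sigma_map M b x))%:E).
  apply/measurable_EFinP; exact: measurableT_comp mg (measurable_sigma_map M b).
rewrite -ge0_integral_sum//; last by move=> b x _; rewrite lee_fin.
rewrite -ge0_integralZl_EFin ?invr_ge0//.
- by apply: eq_integral => x _; rewrite /avg EFinM sumEFin.
- by move=> x _; apply: sume_ge0 => b _; rewrite lee_fin.
- exact: emeasurable_sum.
Qed.

(** The self-similarity equation presents [mu] as a finite average of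
pushforwards. *)
Lemma ge0_integral_hutchinson (g : V -> R) :
  measurable_fun [set: V] g -> (forall x, 0 <= g x) ->
  (\int[mu]_x (g x)%:E = \int[mu]_x (avg M B g x)%:E)%E.
Proof.
move=> mg g0; rewrite ge0_integral_avg//.
have c0 : 0 <= #|` B|%:R^-1 :> R by rewrite invr_ge0.
pose m_ (k : nat) : {measure set V -> \bar R} :=
  measure_function_pushforward__canonical__measure_function_Measure mu
    (measurable_sigma_map M (nth 0 B k)).
have mg' : measurable_fun [set: V] (fun x => (g x)%:E) by exact/measurable_EFinP.
rewrite (eq_measure_integral (mscale (NngNum c0) (msum m_ (size B)))); last first.
  move=> D mD _; have [_ /(_ D mD) E] := hmu; apply: etrans E _.
  by rewrite (big_nth 0) big_mkord /mscale/= /msum.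
rewrite ge0_integral_mscale//; last by move=> x _; rewrite lee_fin.
rewrite ge0_integral_measure_sum//; last by move=> x _; rewrite lee_fin.
congr (_ * _)%E; rewrite (big_nth 0) big_mkord; apply: eq_bigr => k _.
rewrite -(preimage_setT (sigma_map M (nth 0 B k))).
apply: (ge0_integral_pushforward (measurable_sigma_map M _) mu measurableT mg').
by move=> x _; rewrite lee_fin.
Qed.

Lemma integral_hutchinson_iter n (g : V -> R) :
  measurable_fun [set: V] g -> (forall x, 0 <= g x) ->
  (\int[mu]_x (g x)%:E = \int[mu]_x (iter n (avg M B) g x)%:E)%E.
Proof.
move=> mg g0; elim: n => //= n ->; apply: ge0_integral_hutchinson.
  exact: measurable_iter_avg.
exact: iter_avg_ge0.
Qed.

Lemma hutchinson_box : exists2 r, mu (box r) = 1%E & mu (~` box r) = 0%E.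
Proof.
have [[K cK K1] _] := hmu.
have [r Kr] := bounded_set_box (compact_bounded cK).
have mK : measurable K.
  by rewrite -[K]setCK; apply: measurableC; apply: measurable_open_cV;
    apply: closed_openC; apply: compact_closed => //; exact: norm_hausdorff.
have mb := @measurable_box R d r.
have b1 : mu (box r) = 1%E.
  apply/eqP; rewrite eq_le probability_le1//= -K1.
  by apply: le_measure; rewrite ?inE.
by exists r => //; rewrite probability_setC// b1 subee.
Qed.

End hutchinson.

Lemma le_limn_esup (R : realType) (u v : (\bar R)^nat) :
  (forall n, u n <= v n)%E -> (limn_esup u <= limn_esup v)%E.
Proof.
move=> uv; rewrite !limn_esup_lim; apply: lee_lim.
- exact: is_cvg_esups.
- exact: is_cvg_esups.
- apply: nearW => n; apply: ge_ereal_sup => _ [k /= nk <-].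
  by apply: le_trans (uv k) _; apply: ereal_sup_ubound; exists k.
Qed.

Lemma le_limn_einf (R : realType) (u v : (\bar R)^nat) :
  (forall n, u n <= v n)%E -> (limn_einf u <= limn_einf v)%E.
Proof.
move=> uv; rewrite -[leLHS]oppeK -[leRHS]oppeK -!limn_esupN leeN2.
by apply: le_limn_esup => n /=; rewrite leeN2.
Qed.

Section level_averages.
Context {R : realType} {d : nat}.
Local Notation V := 'cV[R]_d.
Local Notation LT := (lebesgueT R d).
Local Notation m_d := (lebesgue_measureT R d).
Variables (Omega Lambda : set V) (a A : R) (M : 'M[R]_d) (B L : {fset V}).
Hypothesis hpair : generalized_spectral_pair Omega Lambda a A.
Hypothesis hM : expansive M.
Hypothesis hii : mulmx M @` dual_set Lambda `<=` dual_set Lambda.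
Hypothesis hiii : [set` B] `<=` dual_set Lambda.
Hypothesis hiv : [set` L] `<=` mulmx (invmx M^T) @` dual_set (dual_set Lambda).
Hypothesis hv : forall l l' : V, l \in L -> l' \in L -> l != l' ->
  [set l + t | t in dual_set (dual_set Lambda)] `&`
  [set l' + t | t in dual_set (dual_set Lambda)] = set0.
Hypothesis horth : forall b b' : V, b \in B -> b' \in B -> b != b' ->
  \sum_(l <- L) expi (b - b') l = 0.
Hypothesis B0 : (0 < #|` B|)%N.
Hypothesis L0 : (0 < #|` L|)%N.
Local Notation level n := (level_measure M B Omega n).

Let uM : M \in unitmx. Proof. exact: expansive_unitmx. Qed.

Let vol0 : 0 < fine (m_d Omega).
Proof. by case: hpair => _ /andP[m0 moo] _ _; rewrite fine_gt0// m0. Qed.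

Let volE : m_d Omega = (fine (m_d Omega))%:E.
Proof.
by case: hpair => _ /andP[m0 moo] _ _; rewrite fineK// ge0_fin_numE// ltW.
Qed.

(** The Jacobian of a branch turns the normalization of level [n.+1] into that of
level [n] divided by [|B|]. *)
Lemma integral_levelS n (h : V -> R) :
  measurable_fun [set: V] h -> (forall x, 0 <= h x) ->
  (\int[level n.+1]_x (h x)%:E = \int[level n]_x (avg M B h x)%:E)%E.
Proof.
move=> mh h0.
have mhE : measurable_fun [set: V] (fun x => (h x)%:E) by exact/measurable_EFinP.
have hE0 x : (0 <= (h x)%:E)%E by rewrite lee_fin.
have mhb b : measurable_fun [set: V] (fun x => (h (sigma_map M b x))%:E).
  exact: (measurableT_comp mhE (measurable_sigma_map M b)).
have lev := ge0_integral_level hpair uM hii hiii hiv hv horth B0 L0.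
rewrite (ge0_integral_avg M B (level n) mh h0) (lev n.+1 _ mhE hE0).
rewrite (ge0_integral_Omega_iterS hpair uM hii hiii hiv hv horth B0 L0
  n (measurableT_comp mhE measurable_id_lebesgueT) hE0).
rewrite (eq_bigr _ (fun b _ => lev n _ (mhb b) (fun x => hE0 _))).
rewrite -ge0_sume_distrr; last by move=> b _; apply: integral_ge0 => x _.
rewrite !muleA -!EFinM; congr (_%:E * _)%E.
have J0 := unitmx_det_norm_gt0 uM.
have b0 : #|` B|%:R != 0 :> R by rewrite pnatr_eq0 -lt0n.
rewrite !exprS; field.
by rewrite gt_eqF//= expf_neq0//= b0 gt_eqF.
Qed.

Lemma integral_level_iter_avg n (h : V -> R) :
  measurable_fun [set: V] h -> (forall x, 0 <= h x) ->
  (\int[level n]_x (h x)%:E = \int[level 0%N]_x (iter n (avg M B) h x)%:E)%E.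
Proof.
elim: n h => [//|n ih] h mh h0; rewrite integral_levelS// ih -?iterSr//.
  exact: measurable_avg.
exact: avg_ge0.
Qed.

(** Both the iterated averages integrated against [mu_0] and those integrated
against [mu] are asymptotic to the values at the origin, and the latter do not
depend on the level. *)
Lemma cvg_integral_level (mu : probability V R) (D : set V) (g : V -> R) (K : R) :
  hutchinson_measure M B mu -> continuous g -> (forall x, 0 <= g x) ->
  measurable D -> Omega `<=` D -> mu D = 1%E -> mu (~` D) = 0%E ->
  (forall n x, D x -> iter n (avg M B) g x <= K) ->
  (\int[level n]_x (g x)%:E)%E @[n --> \oo] --> (\int[mu]_x (g x)%:E)%E.
Proof.
move=> hmu cg g0 mD OD muD muDc gK.
have mg := measurable_fun_continuous_cV cg.
have level0 (E : set V) :
    (level 0%N E = (fine (m_d Omega))^-1%:E * m_d (E `&` Omega))%E.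
  by rewrite /level_measure !expr0 !mul1r.
have lev1 : level 0%N D = 1%E.
  by rewrite level0 (setIidr OD) volE -EFinM mulVf// gt_eqF.
have lev0 : level 0%N (~` D) = 0%E.
  rewrite level0 (_ : ~` D `&` Omega = set0) ?measure0 ?mule0//.
  by apply/seteqP; split => // x [nD /OD].
have [E1 c1] := integral_iter_avg_cvg B0 hM cg g0 mD muD muDc gK.
have [E2 c2] := integral_iter_avg_cvg B0 hM cg g0 mD lev1 lev0 gK.
have muE n : (\int[mu]_x (g x)%:E = (Rintegral mu D (iter n (avg M B) g))%:E)%E.
  by rewrite (integral_hutchinson_iter hmu n mg g0) E1.
pose I := Rintegral mu D (iter 0 (avg M B) g).
have e n : Rintegral mu D (iter n (avg M B) g) = I.
  by apply: EFin_inj; rewrite -!muE.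
have H : Rintegral (level 0%N) D (iter n (avg M B) g) @[n --> \oo] --> I.
  rewrite (_ : (fun n => _) = (fun n =>
    (Rintegral (level 0%N) D (iter n (avg M B) g) - iter n (avg M B) g 0) -
    (Rintegral mu D (iter n (avg M B) g) - iter n (avg M B) g 0) + I)).
    rewrite -[X in _ --> X]add0r -[X in _ --> X + _](subrr 0).
    exact: cvgD (cvgB c2 c1) (cvg_cst I).
  by apply/funext => n; rewrite e; ring.
have -> : (fun n => \int[level n]_x (g x)%:E)%E =
    EFin \o (fun n => Rintegral (level 0%N) D (iter n (avg M B) g)).
  by apply/funext => n; rewrite (integral_level_iter_avg _ mg g0) E2.
by rewrite (muE 0%N); exact: cvg_comp H _.
Qed.

End level_averages.


(** * The frame inequalities in the limit *)

Theorem proposition3p2p1 (R : realType) (d : nat)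
    (Omega Lambda : set 'cV[R]_d) (a A : R)
    (B L : {fset 'cV[R]_d}) (M : 'M[R]_d)
    (mu : probability 'cV[R]_d R)
    (hpair : generalized_spectral_pair Omega Lambda a A)
    (hM : expansive M)
    (hi : \rank (exp_matrix B L) = #|` B|)
    (hii : mulmx M @` dual_set Lambda `<=` dual_set Lambda)
    (hiii : [set` B] `<=` dual_set Lambda)
    (hiv : [set` L] `<=` mulmx (invmx M^T) @` dual_set (dual_set Lambda))
    (hv : forall l l' : 'cV[R]_d, l \in L -> l' \in L -> l != l' ->
       [set l + t | t in dual_set (dual_set Lambda)] `&`
       [set l' + t | t in dual_set (dual_set Lambda)] = set0)
    (horth : forall b b' : 'cV[R]_d, b \in B -> b' \in B -> b != b' ->
       \sum_(l <- L) expi (b - b') l = 0)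
    (hmu : hutchinson_measure M B mu)
    (f : 'cV[R]_d -> R[i])
    (hf : continuous (f : 'cV[R]_d -> R[i]^o))
    (hbd : bounded_set Omega \/ exists C : R, forall x, normc (f x) <= C) :
  let S (n : nat) : \bar R :=
    (((#|` B|%:R / #|` L|%:R) ^+ n)%:E *
     \esum_(lam in Lambda_iter M L Lambda n)
       (normc (level_Fourier M B Omega n f lam) ^+ 2)%:E)%E in
  ((a / fine (lebesgue_measureT R d Omega))%:E * sqnorm2 mu setT f
     <= limn_einf S)%E /\
  (limn_esup S
     <= (A / fine (lebesgue_measureT R d Omega))%:E * sqnorm2 mu setT f)%E.
Proof.
move=> S.
have uM := expansive_unitmx hM.
have B0 := hutchinson_card_gt0 hmu.
(* [B] is nonempty because [mu] has mass one, and the rank is at most [|L|]. *)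
have L0 : (0 < #|` L|)%N by apply: leq_trans B0 _; rewrite -hi rank_leq_row.
pose g x := normc (f x) ^+ 2.
have g0 x : 0 <= g x by exact: sqr_ge0.
have cRe := continuous_lip_comp hf (@Re_lip R).
have cIm := continuous_lip_comp hf (@Im_lip R).
have mf : Cmeasurable_fun [set: 'cV[R]_d] f.
  by split; exact: measurable_fun_continuous_cV.
have cg : continuous g.
  move=> x; rewrite /g; under eq_fun do rewrite normc_sqr.
  have c1 := cRe x; have c2 := cIm x.
  exact: (cvgD (cvgM c1 c1) (cvgM c2 c2)).
have mg : measurable_fun [set: 'cV[R]_d] g := measurable_normc_sqr mf.
pose V := 'cV[R]_d.
pose m_d := lebesgue_measureT R d.
pose level n := level_measure M B Omega n.
have volE : m_d Omega = (fine (m_d Omega))%:E.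
  by case: hpair => _ /andP[m0 moo] _ _; rewrite fineK// ge0_fin_numE// ltW.
(* A set carrying both [mu_0] and [mu], on which all the averages are bounded. *)
have [D [mD OD muD muDc] [K gK OnK]] : exists2 D : set V,
    [/\ measurable D, Omega `<=` D, mu D = 1%E & mu (~` D) = 0%E] &
    exists2 K, forall n x, D x -> iter n (avg M B) g x <= K &
      forall n x, Omega_iter M B Omega n x -> g x <= K.
  case: hbd => [/bounded_set_box[r1 Or1]|[C fC]].
  - have [r2 mu1 mu0] := hutchinson_box hmu.
    pose r := Num.max r1 r2.
    have sub1 : (box r1 : set V) `<=` box r by apply: box_le; rewrite le_max lexx.
    have sub2 : (box r2 : set V) `<=` box r by apply: box_le; rewrite le_max lexx orbT.
    have mb r' := @measurable_box R d r'.
    have [K1 hK1] := iter_avg_bounded_box B0 hM r cg.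
    have [C hC] := Omega_iter_box B hM r.
    have [K2 hK2] := continuous_bounded_box C cg.
    exists (box r).
      split=> //; first exact: subset_trans sub1.
        apply/eqP; rewrite eq_le probability_le1//= -mu1.
        by apply: le_measure; rewrite ?inE.
      apply/eqP; rewrite -measure_le0 -mu0.
      apply: le_measure; rewrite ?inE; try exact: measurableC.
      exact: subsetC.
    exists (Num.max K1 K2) => n x xD.
      by rewrite le_max hK1.
    rewrite le_max hK2 ?orbT//; apply: (hC n).
    by apply: Omega_iter_subset xD; exact: subset_trans sub1.
  - have gC x : g x <= C ^+ 2.
      by rewrite lerXn2r// nnegrE ?normc_ge0// (le_trans (normc_ge0 (f x))).
    exists setT; first by rewrite setCT probability_setT measure0.
    exists (C ^+ 2) => n x // _.
    by apply: (iter_avg_le B0 (S := setT)) => // p _; exact: gC.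
have mOn n : measurable (Omega_iter M B Omega n : set (lebesgueT R d)).
  exact: (measurable_Omega_iter hpair uM hii hiii hiv hv horth B0 L0).
have L2f n : L2 m_d (Omega_iter M B Omega n) f.
  have [f1 f2] := Cmeasurable_lebesgueT (Omega_iter M B Omega n) mf.
  split => //.
  apply: (@le_lt_trans _ _ (\int[m_d]_(x in Omega_iter M B Omega n) K%:E)%E).
    apply: (ge0_le_integral _ (mOn n)).
    - by move=> x _; rewrite lee_fin; exact: g0.
    - exact: (measurable_normc_sqr_EFin (conj f1 f2)).
    - exact: measurable_cst.
    - by move=> x xn; rewrite lee_fin; exact: (OnK n).
  rewrite integral_cst; last exact: mOn.
  rewrite (lebesgueT_Omega_iter hpair uM hii hiii hiv hv horth B0 L0) volE.
  by rewrite -!EFinM ltry.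
have bounds n := level_frame_bounds hpair uM hii hiii hiv hv horth B0 L0 mf (L2f n).
have lim := cvg_integral_level hpair hM hii hiii hiv hv horth B0 L0 hmu cg g0
  mD OD muD muDc gK.
have limc (c : R) : (c%:E * \int[level n]_x (g x)%:E)%E @[n --> \oo] -->
    (c%:E * \int[mu]_x (g x)%:E)%E.
  exact: cvgeZl.
split.
  rewrite -(cvg_limn_einf_sup (limc _)).1.
  by apply: le_limn_einf => n; have [] := bounds n.
rewrite -(cvg_limn_einf_sup (limc _)).2.
by apply: le_limn_esup => n; have [] := bounds n.
Qed.
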